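(* Let $P$ be a sub-Gaussian distribution on $\mathbb{R}$, let $X_1,X_2,\ldots$ be i.i.d. samples from $P$, and let $C_n>0$. Then $$|\hat\xi_n^2-\xi_*^2|\le \sup_{|\lambda|\le C_n}|L_n(\lambda)-L(\lambda)|+\max\{\delta_P(C_n),0\}.$$ Consequently, if $C_n=(\log n)^\alpha$ for any $\alpha\in(0,1/2)$, then, as $n\to\infty$: (a) $\hat\xi_n^2\to\xi_*^2$ in probability; (b) if there is $C_0>0$ such that $\delta_P(C_0)\le 0$, then $\hat\xi_n^2-\xi_*^2=O_p(n^{-1/2+\varepsilon})$ for all $\varepsilon>0$; (c) if there is $C_0>0$ such that $\delta_P(C_0)<0$, then $\hat\xi_n^2-\xi_*^2=O_p(n^{-1/2})$.
   Context: A distribution $P$ on $\mathbb{R}$ (with $X\sim P$) is sub-Gaussian if there is $\xi^2>0$ with $\mathbb{E}[e^{\lambda X}]\le e^{\lambda^2\xi^2/2}$ for all $\lambda\in\mathbb{R}$ (this forces $\mathbb{E}X=0$); $\xi_*^2=\xi_*^2(P)\ge 0$ denotes the smallest such number. Let $L(\lambda)=L(\lambda;P)=\frac{2}{\lambda^2}\log\mathbb{E}_P[e^{\lambda X}]$ for $\lambda\ne0$ and $L(0)=\mathrm{Var}(X)$. With $\bar X=\frac1n\sum_{i=1}^n X_i$, let $L_n(\lambda)=\frac{2}{\lambda^2}\log\bigl\{\frac1n\sum_{i=1}^n e^{\lambda(X_i-\bar X)}\bigr\}$ for $\lambda\neq 0$ and $L_n(0)=\frac1n\sum_{i=1}^n(X_i-\bar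 X)^2$. The estimator is $\hat\xi_n^2=\sup_{|\lambda|\le C_n}L_n(\lambda)$. The truncation gap is $\delta_P(C)=\sup_{|\lambda|\ge C}L(\lambda;P)-\sup_{|\lambda|\le C}L(\lambda;P)$ for $C\ge 0$. *)

(* Defs.v *)
From HB Require Import structures.
From mathcomp Require Export all_boot all_order all_algebra.
From mathcomp Require Export all_classical all_reals all_analysis.

Set Implicit Arguments.
Unset Strict Implicit.
Unset Printing Implicit Defensive.

Import Order.TTheory GRing.Theory Num.Theory.
Import numFieldNormedType.Exports.

Local Open Scope classical_set_scope.
Local Open Scope ring_scope.

(* The moment generating function is extended-real valued, so [proxy_bound]
   includes its finiteness at every [l]. *)
Definition proxy_bound (R : realType) (P : probability (measurableTypeR R) R)
    (s : R) : Prop :=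
  forall l : R, ('M_P idfun l <= (expR (l ^+ 2 * s / 2))%:E)%E.

Definition sub_gaussian (R : realType)
    (P : probability (measurableTypeR R) R) : Prop :=
  exists xi : R, 0 < xi ^+ 2 /\ proxy_bound P (xi ^+ 2).

(* The value 0 is allowed, for the point mass at 0.  For a sub-Gaussian [P]
   the infimum is a minimum, see [var_proxy_min]. *)
Definition var_proxy (R : realType)
    (P : probability (measurableTypeR R) R) : R :=
  inf [set s : R | 0 <= s /\ proxy_bound P s].

Definition L_pop (R : realType) (P : probability (measurableTypeR R) R)
    (l : R) : R :=
  if l == 0 then fine 'V_P[idfun]
  else 2 / l ^+ 2 * ln (fine ('M_P idfun l)).

(* The sample of size [n] consists of the first [n] terms of [x]; all the
   empirical quantities below are meaningful for [0 < n] only. *)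
Definition sample_mean (R : realType) (x : nat -> R) (n : nat) : R :=
  n%:R^-1 * \sum_(i < n) x i.

Definition L_emp (R : realType) (x : nat -> R) (n : nat) (l : R) : R :=
  if l == 0 then n%:R^-1 * \sum_(i < n) (x i - sample_mean x n) ^+ 2
  else 2 / l ^+ 2 *
       ln (n%:R^-1 * \sum_(i < n) expR (l * (x i - sample_mean x n))).

(* The suprema below are real suprema, over nonempty sets that are bounded as
   soon as [P] is sub-Gaussian: then 0 <= L <= var_proxy P, and, for 0 < n,
   L_n is nonnegative and bounded by the square of the sample range. *)
Definition proxy_est (R : realType) (x : nat -> R) (n : nat) (C : R) : R :=
  sup [set L_emp x n l | l in [set l : R | `|l| <= C]].

Definition trunc_gap (R : realType) (P : probability (measurableTypeR R) R)
    (C : R) : R :=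
  sup [set L_pop P l | l in [set l : R | C <= `|l|]]
  - sup [set L_pop P l | l in [set l : R | `|l| <= C]].

Definition mutually_independent (R : realType) (d : measure_display)
    (Omega : measurableType d) (Pr : probability Omega R)
    (X : nat -> {RV Pr >-> measurableTypeR R}) : Prop :=
  forall (s : seq nat) (A : nat -> set (measurableTypeR R)),
    uniq s -> (forall i, measurable (A i)) ->
    (Pr (\bigcap_(i in [set` s]) (X i @^-1` A i))
     = \prod_(i <- s) Pr (X i @^-1` A i))%E.

Definition iid_sample (R : realType) (P : probability (measurableTypeR R) R)
    (d : measure_display) (Omega : measurableType d) (Pr : probability Omega R)
    (X : nat -> {RV Pr >-> measurableTypeR R}) : Prop :=
  mutually_independent X /\
  forall (i : nat) (A : set (measurableTypeR R)),
    measurable A -> distribution Pr (X i) A = P A.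

Definition cvg_in_probability (R : realType) (d : measure_display)
    (Omega : measurableType d) (Pr : probability Omega R)
    (Y : nat -> Omega -> R) (c : R) : Prop :=
  forall e : R, 0 < e ->
    Pr [set w | e <= `|Y n w - c|] @[n --> \oo] --> 0%E.

Definition bigO_in_probability (R : realType) (d : measure_display)
    (Omega : measurableType d) (Pr : probability Omega R)
    (Y : nat -> Omega -> R) (a : nat -> R) : Prop :=
  forall e : R, 0 < e -> exists2 M : R, 0 < M &
    \forall n \near \oo, (Pr [set w | (M * a n < `|Y n w|)%R] <= e%:E)%E.

Lemma var_proxy_min (R : realType) (P : probability (measurableTypeR R) R) :
  sub_gaussian P ->
  [/\ 0 <= var_proxy P, proxy_bound P (var_proxy P)
    & forall s, 0 <= s -> proxy_bound P s -> var_proxy P <= s].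
Proof.
move=> [xi [xi0 bxi]].
set S := [set s : R | 0 <= s /\ proxy_bound P s].
have S0 : S !=set0 by exists (xi ^+ 2); split => //; exact: ltW.
have lbS : has_lbound S by exists 0 => s [].
split.
- by apply: lb_le_inf => // s [].
- move=> l; have := bxi l.
  have [->|l0] := eqVneq l 0; first by rewrite expr0n /= !mul0r.
  case E : ('M_P idfun l)%E => [m| |] // _; last by rewrite leNye.
  rewrite lee_fin.
  have [m0|m0] := leP m 0; first exact: le_trans m0 (expR_ge0 _).
  have l2 : 0 < l ^+ 2 by rewrite exprn_even_gt0.
  have bE s : (m <= expR (l ^+ 2 * s / 2)) = (ln m * 2 / l ^+ 2 <= s).
    by rewrite -{1}(lnK m0) ler_expR ler_pdivlMr // ler_pdivrMr // [s * _]mulrC.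
  rewrite bE; apply: lb_le_inf => // s [_ /(_ l)].
  by rewrite E lee_fin bE.
- by move=> s s0 bs; apply: ge_inf.
Qed.

(* Main.v *)
(* The empirical and the population moment generating functions M_n(l) and M(l)
   are compared through their power series: with D_k the deviation of the k-th
   empirical moment, M_n(l) - M(l) - l * mean is the sum over k >= 2 of
   D_k l^k / k!, so that l^2 factors out and no empirical process bound is
   needed.  By Chebyshev's inequality and a union bound over k, with probability
   at least 1 - 2 / A^2 one has |D_k| <= A n^(-1/2) T_k for all k at once, where
   T_k grows like sqrt(k!) because P is sub-Gaussian.  On this event everything
   is deterministic: sup_{|l| <= C} |L_n(l) - L(l)| is at most a constant times
   A n^(-1/2) (C + C^2) exp(c C^2), and for C = (ln n)^alpha with alpha < 1/2 the
   factor depending on C is smaller than every power of n. *)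
Require Import Defs.
From mathcomp Require Import measurable_realfun ring lra.

Set Implicit Arguments.
Unset Strict Implicit.
Unset Printing Implicit Defensive.

Import Order.TTheory GRing.Theory Num.Theory.
Import numFieldNormedType.Exports.

Local Open Scope classical_set_scope.
Local Open Scope ring_scope.

(** * Elementary inequalities *)

Section RealInequalities.
Variable R : realType.
Implicit Types x y u : R.

(** The factor 2 / l^2 in L_n is the obstacle: a uniform bound on M_n - M says nothing near l = 0,
    where the error must vanish to second order. The order-0 moments agree, and the order-1 term l *
    mean is the one that centring subtracts from ln M_n. Passing to logarithms divides it by M, so a
    remainder l * mean * (1 - 1 / M) survives; it is harmless because ln M <= l^2 s / 2 for the
    variance proxy s. The first inequality rests on s being the supremum of L over the whole line:
    cutting at C loses at most the positive part of the gap. At C_n this loss is eventually below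
    any given error, which suffices for (a), and it is zero as soon as C_n >= C_0 in (b). The
    uniform bound over |l| <= C_n is paid for with n^eps. A strict gap avoids this in (c): on the
    good event the estimator equals the one over a fixed interval, for which the factor depending on
    C is a constant. Events are compared by inclusion, which requires them to be measurable, while
    the estimator is an uncountable supremum; hence the separate treatment of its measurability. *)

Lemma series_exp_coeff_le x n : 0 <= x -> series (exp_coeff x) n <= expR x.
Proof.
move=> x0; rewrite /expR; apply: nondecreasing_cvgn_le.
  apply/nondecreasing_seqP => k; rewrite /series/= big_nat_recr//= lerDl.
  exact: exp_coeff_ge0.
exact: is_cvg_series_exp_coeff.
Qed.

Lemma expR_norm_le x : expR `|x| <= expR x + expR (- x).
Proof.
by case: ger0P => _; rewrite ?lerDl ?lerDr expR_ge0.
Qed.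

Lemma norm_exp_coeff x n : `|exp_coeff x n| = exp_coeff `|x| n.
Proof.
by rewrite /exp_coeff /= normrM normrX [X in _ * X]ger0_norm// invr_ge0.
Qed.

(** A single term of the exponential series of |x|. It makes every moment finite and bounds it by
    the moment generating function at two opposite points. *)
Lemma normX_le_expR x n : `|x| ^+ n <= n`!%:R * (expR x + expR (- x)).
Proof.
rewrite mulrC -ler_pdivrMr ?ltr0n ?fact_gt0//.
apply: le_trans (expR_norm_le x).
have := @series_exp_coeff_le `|x| n.+1 (normr_ge0 _); apply: le_trans.
rewrite /series/= big_nat_recr//= lerDr sumr_ge0// => i _.
exact: exp_coeff_ge0.
Qed.

Lemma expR_ge_quad x : 0 <= x -> 1 + x + x ^+ 2 / 2 <= expR x.
Proof.
move=> x0; apply: le_trans (@series_exp_coeff_le x 3 x0).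
rewrite /series/= !big_nat_recr//= big_nil add0r /exp_coeff/= !fact0.
by rewrite expr0 expr1 (_ : 1`! = 1)%N// (_ : 2`! = 2)%N// !divr1.
Qed.

Lemma sinh_ge x : 0 <= x -> 2 * x <= expR x - expR (- x).
Proof.
move=> x0; have e := expR_ge_quad x0.
have : expR (- x) <= 1 - x + x ^+ 2 / 2; last by lra.
have p : 0 < 1 + x + x ^+ 2 / 2 by nra.
(* Invert the quadratic lower bound on [expR x]: its product with 1 - x + x^2 / 2 is 1 + x^4 / 4,
   hence at least 1. *)
rewrite expRN -[leRHS](@mulfK _ (1 + x + x ^+ 2 / 2)) ?gt_eqF//.
apply: (@le_trans _ _ (1 + x + x ^+ 2 / 2)^-1).
  by rewrite lef_pV2 ?posrE// (lt_le_trans p).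
rewrite ler_peMl ?invr_ge0 ?(ltW p)//.
have -> : (1 - x + x ^+ 2 / 2) * (1 + x + x ^+ 2 / 2) = 1 + (x ^+ 2 / 2) ^+ 2.
  by field.
by rewrite lerDl sqr_ge0.
Qed.

Lemma expRD_expRN_ge x : 2 + x ^+ 2 <= expR x + expR (- x).
Proof.
wlog x0 : x / 0 <= x.
  move=> H; case: (lerP 0 x) => [|/ltW] x0; first exact: H.
  by have := H (- x); rewrite oppr_ge0 sqrrN opprK => /(_ x0); lra.
have h0 : 0 <= x / 2 by lra.
(* Half-angle identity: as a b = 1, the right-hand side is 2 + (a - b)^2, and the bound on a - b
   squares to x^2. *)
have := sinh_ge h0; set a := expR (x / 2); set b := expR (- (x / 2)) => ab.
have ab1 : a * b = 1 by exact: expRxMexpNx_1.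
have -> : expR x = a ^+ 2 by rewrite -expRM_natl; congr expR; field.
have -> : expR (- x) = b ^+ 2 by rewrite -expRM_natl; congr expR; field.
have : x ^+ 2 <= (a - b) ^+ 2 by apply: lerXn2r; rewrite ?nnegrE; lra.
have -> : (a - b) ^+ 2 = a ^+ 2 + b ^+ 2 - 2 * (a * b) by ring.
by rewrite ab1; lra.
Qed.

Lemma expR_subr1_le y : expR y - 1 <= y * expR y.
Proof.
have := expR_ge1Dx (- y); rewrite expRN -subr_ge0 => h.
rewrite -subr_ge0; have := mulr_ge0 h (expR_ge0 y).
by rewrite mulrBl mulVf ?expR_eq0//; lra.
Qed.

(** From e^y - 1 <= y e^y, used twice for y >= 0 and combined with 1 + y <= e^y for y < 0. The
    factor y^2 is what later cancels a division by l^2 or t^2. *)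
Lemma expR_le_quad y : expR y <= 1 + y + y ^+ 2 * expR `|y|.
Proof.
have [y0|y0] := lerP 0 y.
  have h := expR_subr1_le y; have := ler_wpM2l y0 h.
  rewrite mulrA -expr2 ger0_norm//; lra.
have h := expR_subr1_le y; have h1 := expR_ge1Dx y.
have : y ^+ 2 <= y ^+ 2 * expR (- y).
  rewrite ler_peMr ?sqr_ge0// -expR0 ler_expR; lra.
rewrite ltr0_norm//; nra.
Qed.

Lemma ln_upper y : 0 < y -> ln y <= y - 1.
Proof.
move=> y0; rewrite -{1}(subrKC 1 y); apply: le_ln1Dx; lra.
Qed.

Lemma ln_lower y : 0 < y -> 1 - y^-1 <= ln y.
Proof.
move=> y0; have := @ln_upper y^-1; rewrite invr_gt0 => /(_ y0).
by rewrite lnV ?posrE//; lra.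
Qed.

Lemma ln1D_quad u : `|u| <= 1 / 2 -> `|ln (1 + u) - u| <= 2 * u ^+ 2.
Proof.
rewrite ler_norml => /andP[u1 u2].
have p : 0 < 1 + u by lra.
have h1 := ln_upper p; have h2 := ln_lower p.
have h3 : u - 2 * u ^+ 2 <= 1 - (1 + u)^-1.
  rewrite -(ler_pM2r p) [leRHS]mulrBl mulVf ?gt_eqF// mul1r.
  have : 0 <= u ^+ 2 * (1 + 2 * u) by rewrite mulr_ge0 ?sqr_ge0//; lra.
  lra.
have := sqr_ge0 u.
by rewrite ler_norml => u2'; apply/andP; split; lra.
Qed.

End RealInequalities.

(** * The population moment generating function *)

Definition mgf (R : realType) (P : probability (measurableTypeR R) R) (l : R) :=
  \int[P]_x expR (l * x).

Definition moment (R : realType) (P : probability (measurableTypeR R) R) k :=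
  \int[P]_x x ^+ k.

Section RealIntegrable.
Context d (T : measurableType d) (R : realType) (P : probability T R).
Notation intP f := (P.-integrable setT (EFin \o f)).
Implicit Types f g : T -> R.

Lemma integrable_domin f g : measurable_fun setT f -> intP g ->
  (forall x, `|f x| <= g x) -> intP f.
Proof.
move=> mf ig fg; apply: le_integrable ig => //; first exact/measurable_EFinP.
by move=> x _ /=; rewrite lee_fin (le_trans (fg x))// ler_norm.
Qed.

Lemma integrable_const c : intP (fun=> c).
Proof. exact: finite_measure_integrable_cst. Qed.

Lemma integrable_cM (c : R) f : intP f -> intP (fun x => c * f x).
Proof. move=> h; exact: (integrableZl measurableT c h). Qed.

Lemma integrable_plus f g : intP f -> intP g -> intP (fun x => f x + g x).
Proof.
move=> h1 h2; exact: (integrableD measurableT h1 h2).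
Qed.

Lemma Rintegral_const (c : R) : \int[P]_x c = c.
Proof. by rewrite Rintegral_cst//= probability_setT/= mulr1. Qed.

End RealIntegrable.

(** The passage to the limit t -> 0, in a form that replaces differentiating the moment generating
    function at 0. *)
Lemma ler_small_mul (R : realType) (a b K : R) : 0 <= K ->
  (forall t : R, 0 < t -> t <= 1 -> a <= b + t * K) -> a <= b.
Proof.
move=> K0 h; apply/ler_addgt0Pr => e e0.
pose t := Num.min 1 (e / (K + 1)).
have K1 : 0 < K + 1 by lra.
have t0 : 0 < t by rewrite lt_min ltr01 divr_gt0.
apply: (le_trans (h t t0 _)); first by rewrite ge_min lexx.
rewrite lerD2l (@le_trans _ _ (e / (K + 1) * (K + 1)))//; last first.
  by rewrite divfK// gt_eqF.
by apply: ler_pM; rewrite ?(ltW t0)// ?ge_min ?lexx ?orbT//; lra.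
Qed.

Section Population.
Variables (R : realType) (P : probability (measurableTypeR R) R).
Hypothesis subG : sub_gaussian P.
Let s := var_proxy P.
Notation intP f := (P.-integrable setT (EFin \o f)).

Lemma var_proxy_ge0 : 0 <= var_proxy P.
Proof. by case: (var_proxy_min subG). Qed.

Lemma mmt_gen_funE l : ('M_P idfun l = \int[P]_x (expR (l * x))%:E)%E.
Proof.
by rewrite /mmt_gen_fun unlock; apply: eq_integral => x _ /=; rewrite mulrC.
Qed.

Lemma measurable_expRM (l : R) : measurable_fun setT (fun x : R => expR (l * x)).
Proof.
by apply: measurableT_comp => //; exact: measurable_funM.
Qed.

Lemma integrable_expRM l : intP (fun x => expR (l * x)).
Proof.
apply/integrableP; split.
  by apply/measurable_EFinP; exact: measurable_expRM.
have [_ /(_ l) + _] := var_proxy_min subG; rewrite mmt_gen_funE => h.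
apply: le_lt_trans (ltry (expR (l ^+ 2 * s / 2))).
apply: le_trans h; apply: ge0_le_integral => //=.
- apply/measurable_EFinP; apply: measurableT_comp => //.
  exact: measurable_expRM.
- by apply/measurable_EFinP; exact: measurable_expRM.
- by move=> x _; rewrite ger0_norm ?expR_ge0.
Qed.

Lemma integrableX k : intP (fun x => x ^+ k).
Proof.
apply: (@integrable_domin _ (measurableTypeR R) R P _
  (fun x : R => k`!%:R * (expR (1 * x) + expR ((- 1) * x)))).
- exact: measurable_funX.
- apply/integrable_cM/integrable_plus; exact: integrable_expRM.
- by move=> x; rewrite normrX mul1r mulN1r normX_le_expR.
Qed.

Lemma integrable_id : intP (fun x => x).
Proof. exact: (integrableX 1). Qed.

Lemma mgfE l : 'M_P idfun l = (mgf P l)%:E.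
Proof.
rewrite mmt_gen_funE /mgf /Rintegral fineK//.
exact: integrable_fin_num (integrable_expRM l).
Qed.

Lemma mgf_le l : mgf P l <= expR (l ^+ 2 * s / 2).
Proof.
by have [_ /(_ l) + _] := var_proxy_min subG; rewrite mgfE lee_fin.
Qed.

Lemma proxy_boundP t :
  proxy_bound P t <-> forall l, mgf P l <= expR (l ^+ 2 * t / 2).
Proof. by split=> h l; have := h l; rewrite mgfE lee_fin. Qed.

Lemma le_mgf_moment1 l : 1 + l * moment P 1 <= mgf P l.
Proof.
rewrite -[leLHS]/(1 + l * \int[P]_x x) -RintegralZl//; last exact: integrable_id.
rewrite -[X in X + _](Rintegral_const P) -RintegralD//; last 2 first.
- exact: integrable_const.
- exact/integrable_cM/integrable_id.
apply: le_Rintegral => //.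
- apply: integrable_plus; first exact: integrable_const.
  exact/integrable_cM/integrable_id.
- exact: integrable_expRM.
- by move=> x _; exact: expR_ge1Dx.
Qed.

(** The right-hand side has slope 0 at l = 0 and both sides equal 1 there; dividing the difference
    by a small t > 0 leaves [m] below a multiple of t. *)
Lemma ge1_mul_le_expR (m c : R) : 0 <= c ->
  (forall l, 1 + l * m <= expR (l ^+ 2 * c)) -> m <= 0.
Proof.
move=> c0 h; apply: (@ler_small_mul _ _ _ (c + c ^+ 2 * expR c)).
  by rewrite addr_ge0// mulr_ge0 ?sqr_ge0 ?expR_ge0.
move=> t t0 t1; rewrite add0r -(ler_pM2l t0).
have y0 : 0 <= t ^+ 2 * c by rewrite mulr_ge0// sqr_ge0.
have tt : t ^+ 2 <= 1 by rewrite expr_le1// ltW.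
have := h t; have := expR_le_quad (t ^+ 2 * c); rewrite (ger0_norm y0) => h1 h2.
have : (t ^+ 2 * c) ^+ 2 * expR (t ^+ 2 * c) <= t ^+ 2 * (c ^+ 2 * expR c).
  rewrite exprMn -mulrA; apply: ler_pM.
  - exact: sqr_ge0.
  - by rewrite mulr_ge0 ?sqr_ge0 ?expR_ge0.
  - by rewrite expr2 ler_piMl// sqr_ge0.
  - by rewrite ler_wpM2l ?sqr_ge0// ler_expR ler_piMl.
lra.
Qed.

Lemma moment1_eq0 : moment P 1 = 0.
Proof.
have s0 : 0 <= s / 2 by rewrite divr_ge0// var_proxy_ge0.
have h l : 1 + l * moment P 1 <= expR (l ^+ 2 * (s / 2)).
  by rewrite mulrA; apply: le_trans (mgf_le l); exact: le_mgf_moment1.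
apply/eqP; rewrite eq_le -[_ <= moment P 1]oppr_le0.
apply/andP; split; apply: (@ge1_mul_le_expR _ _ s0) => // l.
by rewrite mulrN -mulNr -sqrrN.
Qed.

Lemma mgf_ge1 l : 1 <= mgf P l.
Proof. by have := le_mgf_moment1 l; rewrite moment1_eq0 mulr0 addr0. Qed.

Lemma moment2_le_mgf l : 2 + l ^+ 2 * moment P 2 <= mgf P l + mgf P (- l).
Proof.
have i2 := integrableX 2.
have il := integrable_expRM l; have iNl := integrable_expRM (- l).
have ic := integrable_cM (l ^+ 2) i2.
have <- : \int[P]_x (2 + l ^+ 2 * x ^+ 2) = 2 + l ^+ 2 * moment P 2.
  rewrite RintegralD//; last exact: integrable_const.
  by rewrite Rintegral_const RintegralZl.
have <- : \int[P]_x (expR (l * x) + expR (- l * x)) = mgf P l + mgf P (- l).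
  by rewrite RintegralD.
apply: le_Rintegral => //.
- by apply: integrable_plus => //; exact: integrable_const.
- exact: integrable_plus.
- by move=> x _; rewrite mulNr -exprMn expRD_expRN_ge.
Qed.

(** This is the bound L <= s at l = 0. The symmetrized moment generating function lies between 2 +
    t^2 E[X^2] and 2 exp(t^2 s / 2); compare the coefficients of t^2 as t -> 0. *)
Lemma moment2_le_var_proxy : moment P 2 <= s.
Proof.
have s0 : 0 <= s := var_proxy_ge0.
apply: (@ler_small_mul _ _ _ (s ^+ 2 / 2 * expR (s / 2))).
  by rewrite mulr_ge0 ?expR_ge0// divr_ge0 ?sqr_ge0.
move=> t t0 t1; have t20 : 0 < t ^+ 2 by rewrite exprn_gt0.
have tt : t ^+ 2 <= t by rewrite expr2 ler_piMl// ltW.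
rewrite -(ler_pM2l t20); set y := t ^+ 2 * s / 2.
have y0 : 0 <= y by rewrite divr_ge0// mulr_ge0// ltW.
have := moment2_le_mgf t; have := mgf_le t; have := mgf_le (- t).
rewrite sqrrN -/y; have := expR_le_quad y; rewrite (ger0_norm y0).
have : y ^+ 2 * expR y <= t ^+ 2 * (t * (s ^+ 2 / 2 * expR (s / 2))) / 2.
  have -> : t ^+ 2 * (t * (s ^+ 2 / 2 * expR (s / 2))) / 2 =
    t ^+ 2 * (s / 2) ^+ 2 * (t * expR (s / 2)) by field.
  have -> : y ^+ 2 * expR y = t ^+ 2 * (s / 2) ^+ 2 * (t ^+ 2 * expR y).
    by rewrite /y; field.
  apply: ler_wpM2l; first by rewrite mulr_ge0 ?sqr_ge0.
  apply: ler_pM; rewrite ?expR_ge0 ?sqr_ge0// ler_expR /y -mulrA ler_piMl//; lra.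
have : y = t ^+ 2 * s / 2 by [].
move: (expR y) => E; lra.
Qed.

Lemma L_pop0 : L_pop P 0 = moment P 2.
Proof.
rewrite /L_pop eqxx /variance unlock.
have -> : fine 'E_P[idfun] = 0 by rewrite unlock; exact: moment1_eq0.
rewrite unlock; congr fine; apply: eq_integral => x _.
by rewrite [in LHS]/GRing.mul /= subr0 expr2.
Qed.

Lemma L_popE l : l != 0 -> L_pop P l = 2 / l ^+ 2 * ln (mgf P l).
Proof. by move=> /negbTE l0; rewrite /L_pop l0 mgfE. Qed.

Lemma L_pop_ge0 l : 0 <= L_pop P l.
Proof.
have [->|l0] := eqVneq l 0.
  by rewrite L_pop0; apply: Rintegral_ge0 => x _; exact: sqr_ge0.
by rewrite L_popE// mulr_ge0 ?divr_ge0 ?sqr_ge0// ln_ge0 ?mgf_ge1.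
Qed.

Lemma ln_mgf_le l : ln (mgf P l) <= l ^+ 2 * s / 2.
Proof.
rewrite -ler_expR lnK; first exact: mgf_le.
by rewrite posrE (lt_le_trans ltr01)// mgf_ge1.
Qed.

Lemma L_pop_le l : L_pop P l <= s.
Proof.
have [->|l0] := eqVneq l 0; first by rewrite L_pop0 moment2_le_var_proxy.
have l2 : 0 < l ^+ 2 by rewrite exprn_even_gt0.
rewrite L_popE// mulrAC ler_pdivrMr// mulrC -ler_pdivlMr//.
by rewrite [s * _]mulrC ln_mgf_le.
Qed.

(** Any upper bound on L is itself a proxy. Together with [L_pop_le] this identifies the variance
    proxy with the supremum of L over the line. *)
Lemma var_proxy_le t : 0 <= t -> (forall l, L_pop P l <= t) -> s <= t.
Proof.
move=> t0 h; have [_ _] := var_proxy_min subG; apply => //.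
apply/proxy_boundP => l.
have [->|l0] := eqVneq l 0.
  rewrite expr0n/= !mul0r expR0 /mgf.
  under eq_Rintegral do rewrite mul0r expR0.
  by rewrite Rintegral_const.
have l2 : 0 < l ^+ 2 by rewrite exprn_even_gt0.
have := h l; rewrite L_popE// mulrAC ler_pdivrMr// mulrC -ler_pdivlMr// => h1.
rewrite -[leLHS]lnK ?posrE ?(lt_le_trans ltr01) ?mgf_ge1//.
by rewrite ler_expR [l ^+ 2 * t]mulrC.
Qed.

End Population.

(** * The deterministic inequality *)

Section SupNorm.
Variables (R : realType) (T : Type).
Implicit Types (D : set T) (f g : T -> R).

Lemma le_sup_image D f K t : (forall x, D x -> f x <= K) -> D t ->
  f t <= sup (f @` D).
Proof.
by move=> fK Dt; apply: ub_le_sup; [exists K => _ [x Dx <-]; exact: fK|exists t].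
Qed.

Lemma sup_image_le D f K : D !=set0 -> (forall x, D x -> f x <= K) ->
  sup (f @` D) <= K.
Proof.
by move=> [t Dt] fK; apply: ge_sup; [exists (f t), t|move=> _ [x Dx <-]; exact: fK].
Qed.

(** The supremum is 1-Lipschitz for the uniform distance. The bound on [g] passes to [f], so that
    neither [sup] is a default value. *)
Lemma dist_sup_image_le D f g e : D !=set0 ->
  (exists K, forall x, D x -> g x <= K) ->
  (forall x, D x -> `|f x - g x| <= e) -> `|sup (f @` D) - sup (g @` D)| <= e.
Proof.
move=> D0 [K gK] fge.
have h x : D x -> f x <= g x + e /\ g x <= f x + e.
  by move=> /fge; rewrite ler_norml => /andP[? ?]; split; lra.
have fK x : D x -> f x <= K + e by move=> Dx; have := h x Dx; have := gK x Dx; lra.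
rewrite ler_norml; apply/andP; split; rewrite ?lerBlDr ?lerBrDr.
  rewrite addrC -lerBrDr opprK; apply: sup_image_le => // x Dx.
  have := le_sup_image fK Dx; have := h x Dx; lra.
apply: sup_image_le => // x Dx.
have := le_sup_image gK Dx; have := h x Dx; lra.
Qed.

End SupNorm.

(** * Sample averages and the empirical moment generating function *)

Definition emoment (R : realType) (x : nat -> R) (n k : nat) : R :=
  n%:R^-1 * \sum_(i < n) x i ^+ k.

Definition emgf (R : realType) (x : nat -> R) (n : nat) (l : R) : R :=
  n%:R^-1 * \sum_(i < n) expR (l * x i).

Section Empirical.
Variables (R : realType) (x : nat -> R) (n : nat).
Hypothesis n0 : (0 < n)%N.
Let n_gt0 : 0 < n%:R :> R. Proof. by rewrite ltr0n. Qed.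
Let n_neq0 : n%:R != 0 :> R. Proof. by rewrite gt_eqF. Qed.
Local Notation m := (sample_mean x n).

Lemma average_const (c : R) : n%:R^-1 * \sum_(i < n) c = c.
Proof. by rewrite sumr_const card_ord -(mulr_natl c) mulKf. Qed.

Lemma averageD (f g : nat -> R) : n%:R^-1 * \sum_(i < n) (f i + g i) =
  n%:R^-1 * \sum_(i < n) f i + n%:R^-1 * \sum_(i < n) g i.
Proof. by rewrite big_split mulrDr. Qed.

Lemma averageZ (c : R) (f : nat -> R) : n%:R^-1 * \sum_(i < n) (c * f i) =
  c * (n%:R^-1 * \sum_(i < n) f i).
Proof. by rewrite -mulr_sumr mulrCA. Qed.

Lemma le_average (f g : nat -> R) : (forall i, f i <= g i) ->
  n%:R^-1 * \sum_(i < n) f i <= n%:R^-1 * \sum_(i < n) g i.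
Proof. by move=> fg; rewrite ler_pM2l ?invr_gt0// ler_sum. Qed.

Lemma average_centered : n%:R^-1 * \sum_(i < n) (x i - m) = 0.
Proof. by rewrite (averageD x (fun=> - m)) average_const subrr. Qed.

Lemma emgf_gt0 l : 0 < emgf x n l.
Proof.
rewrite mulr_gt0 ?invr_gt0//; case: n n0 => // k _.
by rewrite big_ord_recl ltr_wpDr ?expR_gt0// sumr_ge0// => i _; exact: expR_ge0.
Qed.

Lemma average_expR_centered l :
  n%:R^-1 * \sum_(i < n) expR (l * (x i - m)) = expR (- (l * m)) * emgf x n l.
Proof.
rewrite /emgf -(averageZ _ (fun i => expR (l * x i))); congr (_ * _).
by apply: eq_bigr => i _; rewrite mulrBr addrC expRD.
Qed.

Lemma L_empE l : l != 0 ->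
  L_emp x n l = 2 / l ^+ 2 * (ln (emgf x n l) - l * m).
Proof.
move=> l0; rewrite /L_emp (negbTE l0) average_expR_centered.
by rewrite lnM ?posrE ?expR_gt0 ?emgf_gt0// expRK addrC.
Qed.

Lemma L_emp0 : L_emp x n 0 = emoment x n 2 - m ^+ 2.
Proof.
rewrite /L_emp eqxx.
transitivity (n%:R^-1 * \sum_(i < n) (x i ^+ 2 + (- m * 2 * x i + m ^+ 2))).
  by congr (_ * _); apply: eq_bigr => i _; ring.
rewrite (averageD (fun i => x i ^+ 2) (fun i => - m * 2 * x i + m ^+ 2)).
rewrite (averageD (fun i => - m * 2 * x i) (fun=> m ^+ 2)) average_const.
by rewrite (averageZ _ x) -/(sample_mean x n) /emoment; ring.
Qed.

Lemma L_emp_ge0 l : 0 <= L_emp x n l.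
Proof.
rewrite /L_emp; case: ifPn => l0.
  by rewrite mulr_ge0 ?invr_ge0// sumr_ge0// => i _; exact: sqr_ge0.
rewrite mulr_ge0 ?divr_ge0 ?sqr_ge0// ln_ge0//.
apply: le_trans (le_average (fun i => expR_ge1Dx (l * (x i - m)))).
rewrite (averageD (fun=> 1) (fun i => l * (x i - m))) average_const.
rewrite (averageZ l (fun i => x i - m)).
by rewrite average_centered mulr0 addr0.
Qed.

(** Use ln v <= v - 1 and the quadratic bound on the exponential: centring kills the linear term of
    the average, so l^2 factors out and cancels. This is what makes [proxy_est] a genuine
    supremum. *)
Lemma L_emp_bounded (C : R) : exists K, forall l, `|l| <= C -> L_emp x n l <= K.
Proof.
pose K := n%:R^-1 * \sum_(i < n) ((x i - m) ^+ 2 * expR (C * `|x i - m|)).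
have K0 : 0 <= K.
  rewrite mulr_ge0 ?invr_ge0// sumr_ge0// => i _.
  by rewrite mulr_ge0 ?sqr_ge0 ?expR_ge0.
exists (2 * K) => l lC; have C0 : 0 <= C by exact: le_trans lC.
have [->|l0] := eqVneq l 0.
  rewrite /L_emp eqxx (@le_trans _ _ K)//; last by lra.
  apply: (@le_average (fun i => (x i - m) ^+ 2)
    (fun i => (x i - m) ^+ 2 * expR (C * `|x i - m|))) => i.
  by rewrite ler_peMr ?sqr_ge0// -expR0 ler_expR mulr_ge0.
have l2 : 0 < l ^+ 2 by rewrite exprn_even_gt0.
rewrite /L_emp (negbTE l0) mulrAC ler_pdivrMr//.
rewrite -mulrA ler_pM2l//; apply: le_trans (ln_upper _) _.
  by rewrite average_expR_centered mulr_gt0 ?expR_gt0 ?emgf_gt0.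
rewrite lerBlDl [K * _]mulrC.
have -> : 1 + l ^+ 2 * K = n%:R^-1 * \sum_(i < n)
   (1 + l * (x i - m) + l ^+ 2 * ((x i - m) ^+ 2 * expR (C * `|x i - m|))).
  rewrite (averageD (fun i => 1 + l * (x i - m))
    (fun i => l ^+ 2 * ((x i - m) ^+ 2 * expR (C * `|x i - m|)))).
  rewrite (averageD (fun=> 1) (fun i => l * (x i - m))) average_const.
  rewrite (averageZ l (fun i => x i - m)) average_centered mulr0 addr0.
  by rewrite (averageZ (l ^+ 2) (fun i => (x i - m) ^+ 2 * expR (C * `|x i - m|))).
apply: (@le_average (fun i => expR (l * (x i - m)))
  (fun i => 1 + l * (x i - m) + l ^+ 2 * ((x i - m) ^+ 2 * expR (C * `|x i - m|)))).
move=> i; apply: le_trans (expR_le_quad _) _.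
rewrite lerD2l exprMn -mulrA ler_wpM2l ?sqr_ge0// ler_wpM2l ?sqr_ge0//.
by rewrite ler_expR normrM ler_wpM2r.
Qed.

End Empirical.

Section Deterministic.
Variables (R : realType) (P : probability (measurableTypeR R) R).
Hypothesis subG : sub_gaussian P.

Lemma ball0_neq0 (C : R) : 0 <= C -> [set l : R | `|l| <= C] !=set0.
Proof. by move=> C0; exists 0; rewrite /= normr0. Qed.

(** With b the supremum over |l| <= C and a the one over |l| >= C, the two ranges cover the line, so
    the variance proxy lies between b and max(a, b). *)
Lemma dist_sup_L_pop (C : R) : 0 <= C ->
  `|sup [set L_pop P l | l in [set l : R | `|l| <= C]] - var_proxy P|
  <= Num.max (trunc_gap P C) 0.
Proof.
move=> C0; rewrite /trunc_gap; set b := sup _; set a := sup _.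
have bnd (D : set R) l : D l -> L_pop P l <= var_proxy P.
  by move=> _; exact: L_pop_le.
have bs : b <= var_proxy P.
  by apply: sup_image_le; [exact: ball0_neq0|exact: bnd].
have sb : var_proxy P <= Num.max a b.
  apply: var_proxy_le => //.
    rewrite le_max; apply/orP; right.
    apply: le_trans (L_pop_ge0 subG 0) (le_sup_image (@bnd _) _).
    by rewrite /= normr0.
  move=> l; rewrite le_max; have [lC|/ltW lC] := lerP `|l| C.
    by apply/orP; right; exact: (le_sup_image (@bnd _)).
  by apply/orP; left; exact: (le_sup_image (@bnd _)).
rewrite ler0_norm ?subr_le0// opprB; move: sb; rewrite !maxEle.
by case: ifP; case: ifP; lra.
Qed.

(** Stated for an arbitrary uniform bound [e], the form in which the good event supplies it. *)
Lemma proxy_est_dist (x : nat -> R) n (C e : R) : (0 < n)%N -> 0 <= C ->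
  (forall l, `|l| <= C -> `|L_emp x n l - L_pop P l| <= e) ->
  `|proxy_est x n C - var_proxy P| <= e + Num.max (trunc_gap P C) 0.
Proof.
move=> n0 C0 h.
set b := sup [set L_pop P l | l in [set l : R | `|l| <= C]].
apply: le_trans (ler_distD b _ _) _; apply: lerD; last exact: dist_sup_L_pop.
apply: dist_sup_image_le => //; first exact: ball0_neq0.
by exists (var_proxy P) => l _; exact: L_pop_le.
Qed.

Lemma proxy_est_dist_sup (x : nat -> R) n (C : R) : (0 < n)%N -> 0 <= C ->
  `|proxy_est x n C - var_proxy P|
  <= sup [set `|L_emp x n l - L_pop P l| | l in [set l : R | `|l| <= C]]
     + Num.max (trunc_gap P C) 0.
Proof.
move=> n0 C0; apply: proxy_est_dist => // l lC.
have [K LK] := L_emp_bounded x n0 C.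
apply: (@le_sup_image _ _ _ (fun l => `|L_emp x n l - L_pop P l|)
  (Num.max K (var_proxy P)) l) => // t tC.
rewrite ler_norml; have := LK t tC; have := L_pop_le subG t.
have := L_pop_ge0 subG t; have := L_emp_ge0 x n0 t.
have : K <= Num.max K (var_proxy P) by rewrite le_max lexx.
have : var_proxy P <= Num.max K (var_proxy P) by rewrite le_max lexx orbT.
by move=> *; apply/andP; split; lra.
Qed.

End Deterministic.

(** * Sub-Gaussian moments and power series *)

Section Factorial.

(** The central binomial coefficient is at most 4^k. *)
Lemma fact_double_le k : ((2 * k)`! <= 4 ^ k * (k`! * k`!))%N.
Proof.
elim: k => // k IH; rewrite mulnS !factS expnS.
have -> : (4 * 4 ^ k * (k.+1 * k`! * (k.+1 * k`!)) =
  (2 * k.+1) * ((2 * k.+1) * (4 ^ k * (k`! * k`!))))%N by ring.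
have e : (2 * k.+1 = (2 * k).+2)%N by rewrite mulnS.
by rewrite e leq_mul2l leq_mul.
Qed.

Lemma fact_le_exp k : (k`! <= k ^ k)%N.
Proof.
suff h j : (j <= k -> j`! <= k ^ j)%N by exact: h.
elim: j => // j IH jk; rewrite factS expnS leq_mul//.
by apply: IH; exact: ltnW.
Qed.

End Factorial.

Section Moments.
Variables (R : realType) (P : probability (measurableTypeR R) R).
Hypothesis subG : sub_gaussian P.
Let s := var_proxy P.
Notation intP f := (P.-integrable setT (EFin \o f)).

(** Geometric growth rate of E[X^(2k)] / k!. The 4 comes from (2k)! <= 4^k k!^2, the exponential
    from the moment generating function at l = sqrt k, which is at most exp(s / 2)^k. *)
Definition moment_rate : R := 4 * expR (var_proxy P / 2).

Lemma moment_rate_gt0 : 0 < moment_rate.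
Proof. by rewrite mulr_gt0// expR_gt0. Qed.

Lemma moment0 : moment P 0 = 1.
Proof.
by rewrite /moment; under eq_Rintegral do rewrite expr0; rewrite Rintegral_const.
Qed.

Lemma moment_mgf_le k (l : R) :
  l ^+ (2 * k) * moment P (2 * k) <= (2 * k)`!%:R * (mgf P l + mgf P (- l)).
Proof.
have il := integrable_expRM subG l; have iNl := integrable_expRM subG (- l).
have ip := integrable_plus il iNl; have iX := integrableX subG (2 * k).
rewrite /mgf -RintegralD// -!RintegralZl//.
apply: le_Rintegral => //; [exact: integrable_cM|exact: integrable_cM|].
move=> x _; rewrite -exprMn mulNr.
by apply: le_trans (normX_le_expR (l * x) (2 * k)); rewrite -normrX ler_norm.
Qed.

Lemma moment_even_le k : moment P (2 * k) <= 2 * moment_rate ^+ k * k`!%:R.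
Proof.
case: k => [|k]; first by rewrite muln0 moment0 expr0 mulr1 fact0 mulr1; lra.
set K := k.+1; have K0 : 0 < K%:R ^+ K :> R by rewrite exprn_gt0// ltr0n.
(* l = sqrt k balances l ^- 2k against expR (l^2 s / 2). *)
have := moment_mgf_le K (Num.sqrt K%:R); rewrite exprM sqr_sqrtr// => h.
rewrite -(ler_pM2l K0); apply: (le_trans h).
have := mgf_le subG (Num.sqrt K%:R); have := mgf_le subG (- Num.sqrt K%:R).
rewrite sqrrN sqr_sqrtr// => h1 h2.
have h3 : (2 * K)`!%:R <= 4 ^+ K * (K%:R ^+ K * K`!%:R) :> R.
  rewrite -!natrX -!natrM ler_nat (leq_trans (fact_double_le K))//.
  by rewrite leq_mul2l leq_mul2r fact_le_exp !orbT.
rewrite (@le_trans _ _ (4 ^+ K * (K%:R ^+ K * K`!%:R) *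
  ((1 + 1) * expR (K%:R * s / 2))))//.
  apply: ler_pM => //; last by rewrite mulrDl mul1r lerD.
  by apply: addr_ge0; apply: Rintegral_ge0 => x _; exact: expR_ge0.
have -> : K%:R * s / 2 = K%:R * (s / 2) by rewrite mulrA.
rewrite /moment_rate exprMn -expRM_natl -/s.
by rewrite le_eqVlt; apply/orP; left; apply/eqP; move: (4 ^+ K) => ?; ring.
Qed.

Lemma integrable_series_exp_coeff l N :
  intP (fun x => series (exp_coeff (l * x)) N).
Proof.
apply: (@integrable_domin _ (measurableTypeR R) R P _
  (fun x : R => expR (l * x) + expR (- l * x))).
- rewrite /series/=; apply: measurable_sum => k.
  rewrite /exp_coeff/=; apply: measurable_funM => //.
  by apply: measurable_funX; exact: measurable_funM.
- exact: integrable_plus (integrable_expRM subG l) (integrable_expRM subG (- l)).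
- move=> x; rewrite mulNr; apply: le_trans (expR_norm_le _).
  apply: le_trans (series_exp_coeff_le N (normr_ge0 _)).
  rewrite /series/=; apply: le_trans (ler_norm_sum _ _ _) _.
  by apply: ler_sum => k _; rewrite norm_exp_coeff.
Qed.

Lemma Rintegral_series_exp_coeff l N :
  \int[P]_x series (exp_coeff (l * x)) N =
  \sum_(0 <= k < N) l ^+ k / k`!%:R * moment P k.
Proof.
elim: N => [|N IH].
  rewrite big_geq//; under eq_Rintegral do rewrite /series/= big_geq//.
  by rewrite Rintegral_const.
rewrite big_nat_recr//= -IH -RintegralZl//; last exact: integrableX.
rewrite -RintegralD//.
- apply: eq_Rintegral => x _; rewrite /series/= big_nat_recr//=.
  by congr (_ + _); rewrite /exp_coeff/= exprMn; ring.
- exact: integrable_series_exp_coeff.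
- exact/integrable_cM/integrableX.
Qed.

(** Dominated convergence: every partial sum is at most exp |l x| in absolute value, hence at most
    e^(l x) + e^(-l x), which is integrable. *)
Lemma mgf_series l :
  (\sum_(0 <= k < N) l ^+ k / k`!%:R * moment P k) @[N --> \oo] --> mgf P l.
Proof.
under eq_fun do rewrite -Rintegral_series_exp_coeff.
have [] := @dominated_convergence _ _ _ P setT measurableT
  (fun N x => (series (exp_coeff (l * x)) N)%:E) (fun x => (expR (l * x))%:E)
  (fun x : R => (expR (l * x) + expR (- l * x))%:E).
- by move=> N; case/integrableP: (integrable_series_exp_coeff l N).
- by apply/measurable_EFinP; exact: measurable_expRM.
- apply: aeW => x _; apply: cvg_EFin; first exact: nearW.
  exact: is_cvg_series_exp_coeff.
- exact: integrable_plus (integrable_expRM subG l) (integrable_expRM subG (- l)).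
- apply: aeW => x N _ /=; rewrite lee_fin.
  rewrite mulNr; apply: le_trans (expR_norm_le _).
  apply: le_trans (series_exp_coeff_le N (normr_ge0 _)).
  rewrite /series/=; apply: le_trans (ler_norm_sum _ _ _) _.
  by apply: ler_sum => k _; rewrite norm_exp_coeff.
move=> _ _ h; apply: fine_cvg; rewrite -(mgfE subG) mmt_gen_funE; exact: h.
Qed.

End Moments.

(** * Samples whose moments are all close to the population moments *)

Section GoodSample.
Variables (R : realType) (P : probability (measurableTypeR R) R).
Hypothesis subG : sub_gaussian P.
Let s := var_proxy P.
Let B := moment_rate P.

(* The factor 2 ^+ k beyond [moment_even_le] makes the union bound over k
   summable. *)
Definition moment_scale (k : nat) : R :=
  Num.sqrt (2 * (2 * moment_rate P) ^+ k * k`!%:R).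

(** A closed bound for the sum over k of C^k / k! times [moment_scale k]. In the exponent, 4 is 2
    from [moment_scale] times 2 from the AM-GM weights; the leading 2 absorbs the geometric series,
    whose sum is at most 1. *)
Definition scale_sum (C : R) : R := 2 * expR (4 * moment_rate P * C ^+ 2).

Lemma moment_scale_gt0 k : 0 < moment_scale k.
Proof.
rewrite sqrtr_gt0 !mulr_gt0 ?exprn_gt0 ?ltr0n ?fact_gt0// mulr_gt0//.
exact: moment_rate_gt0.
Qed.

Lemma scale_sum_gt0 C : 0 < scale_sum C.
Proof. by rewrite mulr_gt0 ?expR_gt0. Qed.

Lemma moment_scale_sqr k :
  moment_scale k ^+ 2 = 2 * (2 * moment_rate P) ^+ k * k`!%:R.
Proof. by rewrite sqr_sqrtr// ltW// -sqrtr_gt0 moment_scale_gt0. Qed.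

(* AM-GM, q <= (2^k q^2 + 2^-k) / 2, trades the square root in [moment_scale] for
   an exponential series. *)
Lemma scale_weight_le (C : R) k : C ^+ k / k`!%:R * moment_scale k <=
  exp_coeff (4 * B * C ^+ 2) k + (2 ^+ k.+1)^-1.
Proof.
set q := C ^+ k / k`!%:R * moment_scale k.
have f0 : 0 < k`!%:R :> R by rewrite ltr0n fact_gt0.
have p0 : 0 < 2 ^+ k :> R by rewrite exprn_gt0.
have -> : exp_coeff (4 * B * C ^+ 2) k = 2 ^+ k * q ^+ 2 / 2.
  have -> : q ^+ 2 = (C ^+ k / k`!%:R) ^+ 2 * (2 * (2 * B) ^+ k * k`!%:R).
    by rewrite /q exprMn moment_scale_sqr.
  rewrite /exp_coeff/=.
  have -> : 4 * B * C ^+ 2 = 2 * (2 * B) * C ^+ 2 by ring.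
  have eC : (C ^+ 2) ^+ k = (C ^+ k) ^+ 2 by rewrite -!exprM mulnC.
  rewrite (exprMn k _ (C ^+ 2)) (exprMn k 2) eC; move: ((2 * B) ^+ k) => ?.
  by field; rewrite gt_eqF.
have -> : (2 ^+ k.+1)^-1 = (2 ^+ k)^-1 / 2 :> R by rewrite exprSr invfM.
have : 0 <= (2 ^+ k * q - 1) ^+ 2 / 2 ^+ k by rewrite divr_ge0 ?sqr_ge0// ltW.
have -> : (2 ^+ k * q - 1) ^+ 2 / 2 ^+ k = 2 ^+ k * q ^+ 2 - 2 * q + (2 ^+ k)^-1.
  by field; rewrite gt_eqF.
lra.
Qed.

Lemma sum_geometric_half N :
  \sum_(0 <= k < N) (2 ^+ k.+1)^-1 = 1 - (2 ^+ N)^-1 :> R.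
Proof.
elim: N => [|N IH]; first by rewrite big_geq// expr0 invr1 subrr.
rewrite big_nat_recr//= IH !exprSr invfM.
have : 2 ^+ N != 0 :> R by rewrite expf_neq0// pnatr_eq0.
by move=> h; field.
Qed.

Lemma scale_series_le (C : R) N :
  \sum_(0 <= k < N) C ^+ k / k`!%:R * moment_scale k <= scale_sum C.
Proof.
apply: (le_trans (ler_sum _ (fun k _ => scale_weight_le C k))).
rewrite big_split/= sum_geometric_half.
have y0 : 0 <= 4 * B * C ^+ 2 
  by rewrite mulr_ge0 ?sqr_ge0// mulr_ge0// ltW// moment_rate_gt0.
have := series_exp_coeff_le N y0; rewrite /series/= /scale_sum -/B.
have : 1 <= expR (4 * B * C ^+ 2) by rewrite -[leLHS]expR0 ler_expR.
have : 0 <= (2 ^+ N)^-1 :> R by rewrite invr_ge0 exprn_ge0.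
lra.
Qed.

Variables (x : nat -> R) (n : nat) (a : R).
Hypotheses (n0 : (0 < n)%N) (a0 : 0 <= a).
Hypothesis good : forall k,
  `|emoment x n k - moment P k| <= a * moment_scale k.

Lemma emgf_series l :
  (\sum_(0 <= k < N) l ^+ k / k`!%:R * emoment x n k) @[N --> \oo] --> emgf x n l.
Proof.
have -> : (fun N => \sum_(0 <= k < N) l ^+ k / k`!%:R * emoment x n k) =
    (fun N => n%:R^-1 * \sum_(i < n) series (exp_coeff (l * x i)) N).
  apply/funext => N; rewrite /series/= exchange_big/= mulr_sumr.
  apply: eq_bigr => k _; rewrite /emoment mulrCA; congr (_ * _).
  by rewrite mulr_sumr; apply: eq_bigr => i _; rewrite /exp_coeff/= exprMn; ring.
apply: cvgMl_tmp; apply: cvg_big => //; first exact: add_continuous.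
by move=> i _; exact: is_cvg_series_exp_coeff.
Qed.

Section Bounds.
Variable C : R.
Hypothesis C1 : 1 <= C.
Let C10 : 0 <= 1 + C. Proof. by rewrite addr_ge0// (le_trans ler01). Qed.
Let eta := a * scale_sum C.

Lemma eta_ge0 : 0 <= eta.
Proof. by rewrite mulr_ge0// ltW// scale_sum_gt0. Qed.

(** One term of a nonnegative series, with C^k dropped because 1 <= C. It puts the errors of the
    mean (k = 1) and of the second moment (k = 2) on the same scale [eta]. *)
Lemma scale_term_le k : moment_scale k <= k`!%:R * scale_sum C.
Proof.
have h : C ^+ k / k`!%:R * moment_scale k <= scale_sum C.
  apply: le_trans (scale_series_le C k.+1).
  rewrite big_nat_recr//= lerDr sumr_ge0// => i _.
  by rewrite !mulr_ge0 ?invr_ge0 ?exprn_ge0 ?sqrtr_ge0// (le_trans ler01).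
rewrite mulrC -ler_pdivrMr ?ltr0n ?fact_gt0//; apply: le_trans h.
rewrite [leRHS]mulrAC ler_pM2r ?invr_gt0 ?ltr0n ?fact_gt0//.
by rewrite ler_peMl ?sqrtr_ge0// exprn_ege1.
Qed.

Lemma sample_mean_le : `|sample_mean x n| <= eta.
Proof.
have := good 1; rewrite moment1_eq0// subr0 => h; apply: (le_trans h).
by rewrite ler_wpM2l// (le_trans (scale_term_le 1))// mul1r.
Qed.

Lemma emoment2_dist : `|emoment x n 2 - moment P 2| <= 2 * eta.
Proof.
apply: (le_trans (good 2)); rewrite /eta mulrCA ler_wpM2l//.
exact: scale_term_le.
Qed.

Lemma emgf_dist l : `|l| <= C ->
  `|emgf x n l - mgf P l - l * sample_mean x n| <= l ^+ 2 * eta.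
Proof.
move=> lC.
pose Z N := \sum_(0 <= k < N) l ^+ k / k`!%:R * (emoment x n k - moment P k).
have Zcvg : Z N @[N --> \oo] --> emgf x n l - mgf P l.
  have -> : Z = (fun N => \sum_(0 <= k < N) l ^+ k / k`!%:R * emoment x n k -
      \sum_(0 <= k < N) l ^+ k / k`!%:R * moment P k).
    apply/funext => N; rewrite /Z -sumrB; apply: eq_bigr => k _.
    by rewrite -mulrBr.
  by apply: cvgB; [exact: emgf_series|exact: mgf_series].
have h : `|Z N - l * sample_mean x n| @[N --> \oo] -->
    `|emgf x n l - mgf P l - l * sample_mean x n|.
  by apply: cvg_norm; apply: cvgB => //; exact: cvg_cst.
apply: (cvgr_to_le h).
exists 2%N => // N /= N2.
(* The term k = 0 vanishes since both moments are 1; the term k = 1 is exactly l times the sample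
   mean since P is centred. *)
have -> : Z N - l * sample_mean x n =
   \sum_(2 <= k < N) l ^+ k / k`!%:R * (emoment x n k - moment P k).
  rewrite /Z big_ltn ?(leq_trans _ N2)// big_ltn ?(leq_trans _ N2)//.
  have -> : emoment x n 0 = 1.
    by rewrite /emoment; under eq_bigr do rewrite expr0; rewrite average_const.
  rewrite moment0 moment1_eq0// -[emoment x n 1]/(sample_mean x n).
  rewrite subrr mulr0 add0r subr0 expr1 (_ : 1`! = 1)%N// divr1.
  by rewrite addrAC subrr add0r.
apply: le_trans (ler_norm_sum _ _ _) _.
rewrite /eta mulrA.
apply: (@le_trans _ _ (l ^+ 2 * a *
    \sum_(0 <= k < N) C ^+ k / k`!%:R * moment_scale k)).
  rewrite mulr_sumr (@big_cat_nat _ _ _ 2 0 N)//=.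
  apply: (@le_trans _ _ (\sum_(2 <= k < N)
     l ^+ 2 * a * (C ^+ k / k`!%:R * moment_scale k))).
    rewrite big_nat_cond [leRHS]big_nat_cond; apply: ler_sum => k.
    rewrite andbT => /andP[k2 _]; rewrite !normrM normrX.
    rewrite [`|_^-1|]ger0_norm ?invr_ge0//.
    have -> : l ^+ 2 * a * (C ^+ k / k`!%:R * moment_scale k) =
       l ^+ 2 * C ^+ k / k`!%:R * (a * moment_scale k) by ring.
    apply: ler_pM; rewrite ?good ?mulr_ge0 ?invr_ge0 ?exprn_ge0//.
    (* |l|^k = l^2 |l|^(k-2) <= l^2 C^(k-2) <= l^2 C^k, the last step by 1 <= C. *)
    rewrite ler_wpM2r ?invr_ge0// -(subnKC k2) !exprD real_normK ?num_real//.
    rewrite ler_wpM2l ?sqr_ge0// (le_trans (lerXn2r _ _ _ lC)) ?nnegrE//.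
      exact: le_trans lC.
    rewrite -[leLHS]mul1r ler_pM ?exprn_ge0 ?exprn_ege1//.
    exact: le_trans lC.
  rewrite lerDr sumr_ge0// => k _; apply: mulr_ge0.
    by rewrite mulr_ge0 ?sqr_ge0.
  rewrite mulr_ge0 ?sqrtr_ge0// divr_ge0 ?exprn_ge0//.
  exact: le_trans lC.
by rewrite ler_wpM2l ?scale_series_le// mulr_ge0 ?sqr_ge0.
Qed.

Hypothesis small : C * (1 + C) * eta <= 1 / 2.

Lemma L_dist l : `|l| <= C ->
  `|L_emp x n l - L_pop P l| <= (6 + s) * (C * eta).
Proof.
move=> lC; have e0 := eta_ge0; have s0 : 0 <= s := var_proxy_ge0 subG.
have Ce : eta <= C * eta by rewrite ler_peMl.
have e1 : (1 + C) * eta <= 1 / 2.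
  by apply: le_trans small; rewrite -mulrA ler_peMl// mulr_ge0.
have sCe : 0 <= s * (C * eta) by rewrite mulr_ge0// (le_trans e0).
have mle := sample_mean_le.
have [->|l0] := eqVneq l 0.
  rewrite L_emp0// L_pop0//.
  have := emoment2_dist; rewrite !ler_norml => /andP[h1 h2].
  have : sample_mean x n ^+ 2 <= eta.
    rewrite -real_normK ?num_real// (@le_trans _ _ (eta ^+ 2))//.
      by apply: lerXn2r; rewrite ?nnegrE.
    by rewrite expr2 ler_piMl//; nra.
  have := sqr_ge0 (sample_mean x n).
  by move=> *; apply/andP; split; nra.
have l2 : 0 < l ^+ 2 by rewrite exprn_even_gt0.
have M1 := mgf_ge1 subG l; have M0 : 0 < mgf P l by lra.
set M := mgf P l in M1 M0; set m := sample_mean x n in mle *.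
have := emgf_dist lC; rewrite -/M -/m; set Z := emgf x n l - M => hZ.
(* With M_n = M (1 + u), L_n - L = 2 / l^2 ((ln (1 + u) - u) + (u - l m)); both
   terms are O(l^2), the second because 1 - 1 / M <= ln M <= l^2 s / 2. *)
pose u := Z / M.
have EM : emgf x n l = M * (1 + u).
  by rewrite /u mulrDr mulr1 mulrCA divff ?gt_eqF// mulr1 /Z addrC subrK.
have Mi : 0 <= M^-1 by rewrite invr_ge0 ltW.
have Mi1 : M^-1 <= 1 by rewrite invf_le1.
have lm : `|l * m| <= `|l| * eta by rewrite normrM ler_wpM2l.
have ll : l ^+ 2 <= `|l| * C.
  by rewrite -real_normK ?num_real// expr2 ler_wpM2l.
have Zle : `|Z| <= `|l| * ((1 + C) * eta).
  have -> : Z = (Z - l * m) + l * m by rewrite subrK.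
  apply: le_trans (ler_normD _ _) _.
  have : l ^+ 2 * eta <= `|l| * C * eta by rewrite ler_wpM2r.
  lra.
have ule : `|u| <= `|Z|.
  by rewrite /u normrM [`|M^-1|]ger0_norm// ler_piMr.
have u2 : u ^+ 2 <= l ^+ 2 * ((1 + C) * eta / 2).
  rewrite -real_normK ?num_real//.
  apply: (@le_trans _ _ ((`|l| * ((1 + C) * eta)) ^+ 2)).
    by apply: lerXn2r; rewrite ?nnegrE// ?(le_trans ule)// (le_trans _ Zle).
  rewrite exprMn real_normK ?num_real// ler_wpM2l ?sqr_ge0// expr2.
  by rewrite ler_wpM2l ?mulr_ge0// -[leRHS]mul1r.
have uh : `|u| <= 1 / 2.
  apply: le_trans (le_trans ule Zle) _; apply: le_trans small.
  by rewrite -mulrA ler_wpM2r// mulr_ge0.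
have ulm : `|u - l * m| <= l ^+ 2 * (eta + C * eta * (s / 2)).
  have -> : u - l * m = (Z - l * m) / M - l * m * (1 - M^-1) by rewrite /u; ring.
  apply: le_trans (ler_normB _ _) _; rewrite [leRHS]mulrDr; apply: lerD.
    rewrite normrM [`|M^-1|]ger0_norm//; apply: le_trans hZ.
    by rewrite ler_piMr.
  have := ln_lower M0; have := ln_mgf_le subG l; rewrite -/M -/s => hl hm.
  have h1 : 0 <= 1 - M^-1 by lra.
  rewrite normrM [X in _ * X]ger0_norm//.
  have -> : l ^+ 2 * (C * eta * (s / 2)) = C * eta * (l ^+ 2 * s / 2) by ring.
  apply: ler_pM => //; last by lra.
  by apply: (le_trans lm); rewrite ler_wpM2r.
have lnu := ln1D_quad uh.
have u1 : 0 < 1 + u by move: uh; rewrite ler_norml => /andP[]; lra.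
have -> : L_emp x n l - L_pop P l = 2 / l ^+ 2 * ((ln (1 + u) - u) + (u - l * m)).
  rewrite L_empE// L_popE// EM lnM ?posrE// -/M -/m; ring.
(* The constant 6 + s, in units of C eta: the logarithmic remainder gives 4 u^2 / l^2 <= 2 (1 + C)
   eta, at most 4 units, and [ulm] gives 2 + s. *)
rewrite normrM ger0_norm ?divr_ge0 ?sqr_ge0// mulrAC ler_pdivrMr//.
have := ler_normD (ln (1 + u) - u) (u - l * m).
have : l ^+ 2 * eta <= l ^+ 2 * (C * eta) by rewrite ler_wpM2l// sqr_ge0.
lra.
Qed.

End Bounds.
End GoodSample.

(** * Independence and second moments *)

Section Independence.
Variables (R : realType) (P : probability (measurableTypeR R) R).
Variables (d : measure_display) (Omega : measurableType d).
Variable Pr : probability Omega R.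
Variable X : nat -> {RV Pr >-> measurableTypeR R}.
Hypothesis iid : iid_sample P X.

Lemma iid_integral i (f : R -> \bar R) : measurable_fun setT f ->
  (forall x, 0 <= f x)%E -> (\int[Pr]_w f (X i w) = \int[P]_x f x)%E.
Proof.
move=> mf f0; rewrite -[LHS](ge0_integral_distribution (X i) mf f0).
by apply: eq_measure_integral => A mA _; case: iid => _; exact.
Qed.

Lemma iid_integrable i (f : R -> R) : P.-integrable setT (EFin \o f) ->
  Pr.-integrable setT (EFin \o (f \o X i)).
Proof.
move=> /integrableP[mf iff]; apply/integrableP; split.
  exact: (measurableT_comp mf).
rewrite (iid_integral i (f := fun x => `|(f x)%:E|%E))//.
exact: measurableT_comp.
Qed.

Lemma iid_Rintegral i (f : R -> R) : P.-integrable setT (EFin \o f) ->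
  \int[Pr]_w f (X i w) = \int[P]_x f x.
Proof.
move=> ifP; rewrite /Rintegral; congr fine.
have mf : measurable_fun setT (EFin \o f) by case/integrableP: ifP.
rewrite -[LHS](@integral_distribution _ _ _ _ _ Pr (X i) (EFin \o f) mf)//.
  by apply: eq_measure_integral => A mA _; case: iid => _; exact.
exact: iid_integrable.
Qed.

Lemma pair_independent i j (A B : set R) : i != j -> measurable A -> measurable B ->
  Pr (X i @^-1` A `&` X j @^-1` B) = (P A * P B)%E.
Proof.
move=> ij mA mB; case: iid => ind sameP.
have := ind [:: i; j] (fun k => if k == i then A else B).
rewrite /= inE ij !big_cons big_nil eqxx [j == i]eq_sym (negbTE ij) mule1.
rewrite -[Pr (X i @^-1` A)]/(distribution Pr (X i) A) sameP//.
rewrite -[Pr (X j @^-1` B)]/(distribution Pr (X j) B) sameP// => <- //; last first.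
  by move=> k; case: ifP.
congr (Pr _); apply/seteqP; split => [w [wA wB] k /=|w h].
  by rewrite !inE => /orP[]/eqP->; rewrite ?eqxx// eq_sym (negbTE ij).
split; first by have := h i; rewrite /= !inE eqxx; apply.
by have := h j; rewrite /= !inE eqxx orbT [j == i]eq_sym (negbTE ij); apply.
Qed.

End Independence.

Section Variance.
Variables (R : realType) (P : probability (measurableTypeR R) R).
Variables (d : measure_display) (Omega : measurableType d).
Variable Pr : probability Omega R.
Variable X : nat -> {RV Pr >-> measurableTypeR R}.
Hypothesis iid : iid_sample P X.

Lemma measurable_pair i j :
  measurable_fun setT (fun w => (X i w, X j w) : measurableTypeR R * measurableTypeR R).
Proof. exact: measurable_fun_pair. Qed.

(** Independence gives equality on rectangles, and these determine the product measure. *)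
Lemma joint_distributionE i j (A : set (measurableTypeR R * measurableTypeR R)) :
  i != j -> measurable A ->
  Pr ((fun w => (X i w, X j w)) @^-1` A) = (P \x P)%E A.
Proof.
move=> ij mA.
pose phi : {mfun Omega >-> (measurableTypeR R * measurableTypeR R)%type} :=
  mfun_Sub (mem_set (measurable_pair i j)).
apply/esym.
apply: (@product_measure_unique _ _ _ _ _ P P (distribution Pr phi)) => //.
move=> B C mB mC; rewrite -(pair_independent iid ij mB mC).
by congr (Pr _); apply/seteqP; split.
Qed.

Lemma sqr_integrable_mul (f g : Omega -> R) :
  measurable_fun setT f -> measurable_fun setT g ->
  Pr.-integrable setT (EFin \o (fun w => f w ^+ 2)) ->
  Pr.-integrable setT (EFin \o (fun w => g w ^+ 2)) ->
  Pr.-integrable setT (EFin \o (fun w => f w * g w)).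
Proof.
move=> mf mg f2 g2.
apply: (@integrable_domin _ _ _ Pr _ (fun w => f w ^+ 2 + g w ^+ 2)).
- exact: measurable_funM.
- exact: integrable_plus.
- move=> w; rewrite ler_norml; have := sqr_ge0 (f w + g w).
  have := sqr_ge0 (f w - g w); rewrite sqrrB sqrrD mulr2n => h1 h2.
  have h3 := sqr_ge0 (f w); have h4 := sqr_ge0 (g w).
  by apply/andP; split; lra.
Qed.

(** Square integrability makes the product integrable on [Omega]; this transfers to the product
    measure through the joint law, and Fubini's theorem separates the factors. *)
Lemma iid_Rintegral_mul i j (f g : measurableTypeR R -> R) : i != j ->
  measurable_fun setT f -> measurable_fun setT g ->
  P.-integrable setT (EFin \o f) -> P.-integrable setT (EFin \o g) ->
  P.-integrable setT (EFin \o (fun x => f x ^+ 2)) ->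
  P.-integrable setT (EFin \o (fun x => g x ^+ 2)) ->
  \int[Pr]_w (f (X i w) * g (X j w)) = (\int[P]_x f x) * \int[P]_x g x.
Proof.
move=> ij mf mg if1 ig1 if2 ig2.
pose phi : {mfun Omega >-> (measurableTypeR R * measurableTypeR R)%type} :=
  mfun_Sub (mem_set (measurable_pair i j)).
pose h (z : measurableTypeR R * measurableTypeR R) := (f z.1 * g z.2)%:E.
have mh : measurable_fun setT h.
  apply/measurable_EFinP; apply: measurable_funM.
    exact: (measurableT_comp mf measurable_fst).
  exact: (measurableT_comp mg measurable_snd).
have ih : Pr.-integrable setT (h \o phi).
  apply: (@sqr_integrable_mul (f \o X i) (g \o X j)).
  - exact: (measurableT_comp mf).
  - exact: (measurableT_comp mg).
  - exact: (iid_integrable iid i if2).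
  - exact: (iid_integrable iid j ig2).
have dE (A : set (measurableTypeR R * measurableTypeR R)) :
    measurable A -> A `<=` setT -> distribution Pr phi A = (P \x P)%E A.
  by move=> mA _; rewrite -(joint_distributionE ij mA).
have ihP : (P \x P)%E.-integrable setT h.
  have mphi : measurable_fun setT phi by exact: measurable_funPT.
  apply/integrableP; split => //.
  have /integrableP[_] := integrable_pushforward mphi mh ih measurableT.
  congr (_ < _)%E; exact: (eq_measure_integral _ dE).
have e1 : (\int[Pr]_w (h \o phi) w = \int[P \x P]_z h z)%E.
  by rewrite -(integral_distribution mh ih); exact: (eq_measure_integral _ dE).
rewrite /Rintegral -[(\int[Pr]__ _)%E]/(\int[Pr]_w (h \o phi) w)%E e1.
rewrite -(integral12_prod_meas1 ihP) /fubini_F/= /h/=.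
have fin := integrable_fin_num measurableT ig1.
have fin' := integrable_fin_num measurableT if1.
under eq_integral => x _.
  under eq_integral => y _ do rewrite EFinM.
  rewrite (@integralZl _ _ _ P setT measurableT _ ig1) -[(\int[P]_y _)%E]fineK// muleC.
  over.
by rewrite (@integralZl _ _ _ P setT measurableT _ if1) fineM// mulrC.
Qed.

End Variance.

(** * Integrals of finite sums and Chebyshev's inequality *)

Section RintegralSum.
Context d (T : measurableType d) (R : realType) (P : probability T R).
Notation intP f := (P.-integrable setT (EFin \o f)).

Lemma integrable_sumR (I : Type) (r : seq I) (F : I -> T -> R) :
  (forall i, intP (F i)) -> intP (fun x => \sum_(i <- r) F i x).
Proof.
move=> iF; elim: r => [|i r IH].
  by under [X in EFin \o X]eq_fun do rewrite big_nil; exact: integrable_const.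
under [X in EFin \o X]eq_fun do rewrite big_cons.
exact: integrable_plus.
Qed.

Lemma Rintegral_sum (I : Type) (r : seq I) (F : I -> T -> R) :
  (forall i, intP (F i)) ->
  \int[P]_x (\sum_(i <- r) F i x) = \sum_(i <- r) \int[P]_x F i x.
Proof.
move=> iF; elim: r => [|i r IH].
  by under eq_Rintegral do rewrite big_nil; rewrite Rintegral_const big_nil.
under eq_Rintegral do rewrite big_cons.
by rewrite RintegralD// ?IH ?big_cons//; exact: integrable_sumR.
Qed.

Lemma chebyshev_sqr (S : T -> R) t : 0 < t -> measurable_fun setT S ->
  intP (fun w => S w ^+ 2) ->
  (P [set w | (t <= `|S w|)%R] <= ((\int[P]_w S w ^+ 2) / t ^+ 2)%:E)%E.
Proof.
move=> t0 mS iS.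
pose Y : {RV P >-> R} := mfun_Sub (mem_set mS).
have t20 : 0 < t ^+ 2 by rewrite exprn_gt0.
rewrite mulrC EFinM lee_pdivlMl// fineK; last exact: integrable_fin_num iS.
have := @markov _ _ _ P Y (fun x => x ^+ 2) t t0; rewrite unlock => h.
apply: le_trans (le_trans (h _ _ _) _).
- by rewrite lee_pmul2l.
- exact: measurable_funX.
- by move=> r _; exact: sqr_ge0.
- by move=> x y; rewrite !nnegrE => x0 y0; rewrite ler_sqr.
- rewrite le_eqVlt; apply/orP; left; apply/eqP; apply: eq_integral => w _ /=.
  by rewrite real_normK// num_real.
Qed.

End RintegralSum.

(** * Deviations of the empirical moments and the union bound *)

Section GoodEvent.
Variables (R : realType) (P : probability (measurableTypeR R) R).
Hypothesis subG : sub_gaussian P.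
Variables (d : measure_display) (Omega : measurableType d).
Variable Pr : probability Omega R.
Variable X : nat -> {RV Pr >-> measurableTypeR R}.
Hypothesis iid : iid_sample P X.

(** In the expanded square the off-diagonal terms factor by independence and vanish by centring; the
    n diagonal terms remain. *)
Lemma Rintegral_sqr_sum (f : measurableTypeR R -> R) n : measurable_fun setT f ->
  P.-integrable setT (EFin \o f) ->
  P.-integrable setT (EFin \o (fun x => f x ^+ 2)) -> \int[P]_x f x = 0 ->
  Pr.-integrable setT (EFin \o (fun w => (\sum_(i < n) f (X i w)) ^+ 2)) /\
  \int[Pr]_w (\sum_(i < n) f (X i w)) ^+ 2 = n%:R * \int[P]_x f x ^+ 2.
Proof.
move=> mf if1 if2 f0.
have iXX (i j : 'I_n) :
    Pr.-integrable setT (EFin \o (fun w => f (X i w) * f (X j w))).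
  apply: (@sqr_integrable_mul _ _ _ Pr (f \o X i) (f \o X j)).
  - exact: (measurableT_comp mf).
  - exact: (measurableT_comp mf).
  - exact: (iid_integrable iid i if2).
  - exact: (iid_integrable iid j if2).
have sqE w : (\sum_(i < n) f (X i w)) ^+ 2 =
    \sum_(i < n) \sum_(j < n) f (X i w) * f (X j w).
  by rewrite expr2 mulr_suml; apply: eq_bigr => i _; rewrite mulr_sumr.
split.
  under [X in EFin \o X]eq_fun do rewrite sqE.
  by apply: integrable_sumR => i; exact: integrable_sumR.
under eq_Rintegral do rewrite sqE.
rewrite Rintegral_sum; last by move=> i; exact: integrable_sumR.
rewrite -[n in RHS]card_ord -sum1_card natr_sum mulr_suml; apply: eq_bigr => i _.
rewrite Rintegral_sum// (bigD1 i)//= big1 => [|j ji]; last first.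
  by rewrite (iid_Rintegral_mul iid)// ?f0 ?mul0r// eq_sym.
by rewrite addr0 mul1r -(iid_Rintegral iid i if2).
Qed.

Lemma measurable_emoment n k :
  measurable_fun setT (fun w => emoment (fun i => X i w) n k).
Proof.
apply: measurable_funM => //; apply: measurable_sum => i.
have mX : measurable_fun setT (fun x : measurableTypeR R => x ^+ k).
  exact: measurable_funX.
exact: (measurableT_comp mX).
Qed.

Lemma measurable_deviation n k a :
  measurable [set w | a < `|emoment (fun i => X i w) n k - moment P k|].
Proof.
rewrite -[X in measurable X]setTI.
have m1 : measurable_fun setT
    (fun w => `|emoment (fun i => X i w) n k - moment P k|).
  apply: measurableT_comp => //; apply: measurable_funB => //.
  exact: measurable_emoment.
by have := m1 measurableT `]a, +oo[%classic (measurable_itv _);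
  rewrite set_itvE.
Qed.

(** Chebyshev's inequality for the centred powers, whose variance is bounded by the raw moment of
    order 2k. *)
Lemma deviation_prob n k (a : R) : (0 < n)%N -> 0 < a ->
  (Pr [set w | (a < `|emoment (fun i => X i w) n k - moment P k|)%R]
   <= (moment P (2 * k) / (n%:R * a ^+ 2))%:E)%E.
Proof.
move=> n0 a0; have n1 : 0 < n%:R :> R by rewrite ltr0n.
pose f (x : measurableTypeR R) : R := x ^+ k - moment P k.
have mf : measurable_fun setT f by apply: measurable_funB => //; exact: measurable_funX.
have ik := integrableX subG k; have i2k := integrableX subG (2 * k).
have if1 : P.-integrable setT (EFin \o f).
  exact: integrable_plus ik (integrable_const P (- moment P k)).
have fE x : f x ^+ 2 =
    x ^+ (2 * k) + (- (2 * moment P k) * x ^+ k + moment P k ^+ 2).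
  by rewrite /f mulnC exprM; ring.
have if2 : P.-integrable setT (EFin \o (fun x => f x ^+ 2)).
  under [X in EFin \o X]eq_fun do rewrite fE.
  apply: integrable_plus => //; apply: integrable_plus; first exact: integrable_cM.
  exact: integrable_const.
have f0 : \int[P]_x f x = 0.
  by rewrite RintegralB// ?Rintegral_const ?subrr//; exact: integrable_const.
have v : \int[P]_x f x ^+ 2 <= moment P (2 * k).
  under eq_Rintegral do rewrite fE.
  rewrite RintegralD//; last first.
    by apply: integrable_plus; [exact: integrable_cM|exact: integrable_const].
  rewrite RintegralD//; last 2 first.
  - exact: integrable_cM.
  - exact: integrable_const.
  rewrite RintegralZl// Rintegral_const -!/(moment P _).
  by have := sqr_ge0 (moment P k); lra.
have [iS ES] := Rintegral_sqr_sum n mf if1 if2 f0.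
have mS : measurable_fun setT (fun w => \sum_(i < n) f (X i w)).
  by apply: measurable_sum => i; exact: (measurableT_comp mf).
have na : 0 < n%:R * a by rewrite mulr_gt0.
have := chebyshev_sqr na mS iS; rewrite ES => h.
apply: (@le_trans _ _ (Pr [set w | (n%:R * a <= `|\sum_(i < n) f (X i w)|)%R])).
  apply: le_measure; rewrite ?inE; first exact: measurable_deviation.
    rewrite -[X in measurable X]setTI.
    have m1 : measurable_fun setT (fun w => `|\sum_(i < n) f (X i w)|).
      exact: measurableT_comp.
    by have := m1 measurableT `[(n%:R * a), +oo[%classic (measurable_itv _);
      rewrite set_itvE.
  move=> w /= /ltW aw.
  have -> : \sum_(i < n) f (X i w) =
      n%:R * (emoment (fun i => X i w) n k - moment P k).
    rewrite /emoment mulrBr mulrA divff ?gt_eqF// mul1r sumrB; congr (_ - _).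
    by rewrite sumr_const card_ord mulr_natl.
  by rewrite normrM ger0_norm ?ler_pM2l// ltW.
apply: (le_trans h); rewrite lee_fin.
have -> : n%:R * \int[P]_x f x ^+ 2 / (n%:R * a) ^+ 2 =
    \int[P]_x f x ^+ 2 / (n%:R * a ^+ 2).
  by field; rewrite !gt_eqF.
by rewrite ler_pM2r// invr_gt0 mulr_gt0// exprn_gt0.
Qed.

Definition good_event (n : nat) (a : R) : set Omega :=
  [set w | forall k,
    `|emoment (fun i => X i w) n k - moment P k| <= a * moment_scale P k].

Lemma good_eventC n a : ~` good_event n a = \bigcup_k
  [set w | a * moment_scale P k < `|emoment (fun i => X i w) n k - moment P k|].
Proof.
apply/seteqP; split => [w /existsNP[k /negP]|w [k _ /= h] /(_ k)].
  by rewrite -ltNge => h; exists k.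
by rewrite leNgt h.
Qed.

Lemma measurable_good_eventC n a : measurable (~` good_event n a).
Proof.
rewrite good_eventC; apply: bigcupT_measurable => k; exact: measurable_deviation.
Qed.

Lemma good_eventC_prob n (a : R) : (0 < n)%N -> 0 < a ->
  (Pr (~` good_event n a) <= (2 / (n%:R * a ^+ 2))%:E)%E.
Proof.
move=> n0 a0; have n1 : 0 < n%:R :> R by rewrite ltr0n.
apply: le_trans.
  apply: (@measure_sigma_subadditive _ _ _ Pr _ _ _ _ (subset_refl _)).
  - by move=> k; exact: (measurable_deviation n k (a * moment_scale P k)).
  - exact: measurable_good_eventC.
  - by rewrite good_eventC.
apply: lime_le; first exact: is_cvg_nneseries.
apply: nearW => N.
have na : 0 < n%:R * a ^+ 2 by rewrite mulr_gt0// exprn_gt0.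
apply: (@le_trans _ _
  (\sum_(0 <= k < N) (2 / (n%:R * a ^+ 2) * (2 ^+ k.+1)^-1)%:E)%E).
  apply: lee_sum => k _.
  have aT : 0 < a * moment_scale P k by rewrite mulr_gt0// moment_scale_gt0.
  apply: le_trans (deviation_prob k n0 aT) _; rewrite lee_fin.
  rewrite ler_pdivrMr; last by rewrite mulr_gt0// exprn_gt0.
  (* The bound 2 B^k k! over the squared scale 2 (2 B)^k k! leaves exactly the geometric weight
     2^-k. *)
  apply: le_trans (moment_even_le subG k) _; rewrite le_eqVlt; apply/orP; left.
  rewrite [(a * _) ^+ 2]exprMn moment_scale_sqr [(2 * _) ^+ k]exprMn (exprS 2 k).
  have p2 : 2 ^+ k != 0 :> R by rewrite expf_neq0// pnatr_eq0.
  move: (2 ^+ k) p2 (moment_rate P ^+ k) => e p2 b.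
  by apply/eqP; field; rewrite p2 !gt_eqF.
rewrite sumEFin lee_fin -mulr_sumr sum_geometric_half ler_piMr//.
  by rewrite divr_ge0// ltW.
Qed.

End GoodEvent.

(** * Measurability of the estimator *)

Section Clip.
Variable R : realType.
Implicit Types C y l : R.

(* [clip C] is 1-Lipschitz and fixes [-C, C], so the points [clip C q] with q
   rational are dense in [-C, C]. *)
Definition clip C y : R := Num.max (- C) (Num.min C y).

Lemma norm_clip_le C y : 0 <= C -> `|clip C y| <= C.
Proof.
move=> C0; rewrite /clip ler_norml le_max lexx/= ge_max ge_min lexx/= andbT.
lra.
Qed.

Lemma clip_dist C y l : `|l| <= C -> `|clip C y - l| <= `|y - l|.
Proof.
rewrite ler_norml => /andP[lC Cl]; rewrite /clip.
case: (leP C y) => h1; case: (leP (- C) _) => h2 //.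
- by rewrite !ger0_norm; lra.
- by lra.
- by rewrite !ler0_norm; lra.
Qed.

End Clip.

Section Continuity.
Variables (R : realType) (x : nat -> R) (n : nat).
Hypothesis n0 : (0 < n)%N.

(* At l = 0 this would need a Taylor expansion of [L_emp]; it is avoided because
   0 is rational. *)
Lemma L_emp_lower_semicontinuous (l t : R) : l != 0 -> t < L_emp x n l ->
  exists2 e : R, 0 < e & forall y, `|y - l| < e -> t < L_emp x n y.
Proof.
move=> l0; pose c i := x i - sample_mean x n.
pose g y := 2 / y ^+ 2 * ln (n%:R^-1 * \sum_(i < n) expR (y * c i)).
have gE y : y != 0 -> L_emp x n y = g y by move=> y0; rewrite /L_emp (negbTE y0).
rewrite gE// => tg.
have cg : g y @[y --> l] --> g l.
  apply: cvgM.
    apply: cvgMl_tmp; apply: cvgV; first by rewrite expf_neq0.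
    by apply: cvgM; exact: cvg_id.
  apply: continuous_cvg.
    apply: continuous_ln; have := average_expR_centered x n l => ->.
    by rewrite mulr_gt0 ?expR_gt0// emgf_gt0.
  apply: cvgMl_tmp; apply: cvg_big => //; first exact: add_continuous.
  move=> i _; apply: continuous_cvg; first exact: continuous_expR.
  by apply: cvgMr_tmp; exact: cvg_id.
have h : \forall y \near l, t < g y by exact: (cvgr_gt _ cg).
have [e /= e0 he] := (nbhs_ballP _ _).1 h.
exists (Num.min e `|l|) => [|y]; first by rewrite lt_min e0 normr_gt0.
rewrite lt_min => /andP[ye yl].
rewrite gE; first by apply: he; rewrite /ball/= distrC.
by apply: contraTneq yl => ->; rewrite sub0r normrN ltxx.
Qed.

End Continuity.

Section Measurability.
Variables (R : realType) (d : measure_display) (Omega : measurableType d).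
Variable X : nat -> {mfun Omega >-> measurableTypeR R}.
Variable n : nat.
Hypothesis n0 : (0 < n)%N.
Local Notation sample w := (fun i => X i w).

(* [measurableTypeR R] and the canonical structure on [R] carry the same Borel
   sets but are not unified by the measurability lemmas. *)
Lemma measurable_RV i : @measurable_fun _ _ Omega R setT (X i).
Proof.
have mid : measurable_fun setT (fun x : measurableTypeR R => x : R).
  exact: measurable_id.
exact: (measurableT_comp mid).
Qed.

Lemma measurable_L_emp l : measurable_fun setT (fun w => L_emp (sample w) n l).
Proof.
have mc i : measurable_fun setT (fun w => X i w - sample_mean (sample w) n).
  apply: measurable_funB; first exact: measurable_RV.
  by apply: measurable_funM => //; apply: measurable_sum => j; exact: measurable_RV.
rewrite /L_emp; case: (l == 0).
  apply: measurable_funM => //; apply: measurable_sum => i.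
  exact: measurable_funX.
apply: measurable_funM => //; apply: (measurableT_comp (@measurable_ln R)).
apply: measurable_funM => //; apply: measurable_sum => i.
by apply: measurableT_comp => //; exact: measurable_funM.
Qed.

(** Exceeding t at some nonzero l is an open condition, so a nearby rational also witnesses it;
    [clip] brings that rational back into [-C, C], including when l is an endpoint. *)
Lemma proxy_est_gtE (C t : R) : 0 <= C ->
  [set w | t < proxy_est (sample w) n C] =
  \bigcup_(q : rat) [set w | t < L_emp (sample w) n (clip C (ratr q))].
Proof.
move=> C0; apply/seteqP; split => w /=.
  move=> tw; have [l lC tl] : exists2 l, `|l| <= C & t < L_emp (sample w) n l.
    apply: contrapT => h; have := tw; rewrite ltNge => /negP; apply.
    apply: sup_image_le; first exact: ball0_neq0.
    by move=> l lC; rewrite leNgt; apply/negP => tl; apply: h; exists l.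
  have [l0|l0] := eqVneq l 0.
    exists 0 => //=; rewrite rmorph0 (_ : clip C 0 = l)//.
    apply/eqP; rewrite -subr_eq0 -normr_le0 (le_trans (clip_dist _ lC))//.
    by rewrite l0 subrr normr0.
  have [e e0 he] := L_emp_lower_semicontinuous n0 l0 tl.
  have [q] : exists q : rat, ratr q \in `](l - e), (l + e)[.
    by apply: rat_in_itvoo; lra.
  rewrite in_itv/= => /andP[q1 q2]; exists q => //=; apply: he.
  by rewrite (le_lt_trans (clip_dist _ lC))// ltr_norml; apply/andP; split; lra.
move=> [q _ /= tq]; apply: (lt_le_trans tq).
have [K LK] := L_emp_bounded (sample w) n0 C.
by apply: (le_sup_image LK); exact: norm_clip_le.
Qed.

Lemma measurable_proxy_est (C : R) : 0 <= C ->
  measurable_fun setT (fun w => proxy_est (sample w) n C).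
Proof.
move=> C0 mT; apply: (measurability _ (RGenOInfty.measurableE R)) => //.
move=> /= _ [_ [t ->] <-]; rewrite setTI preimage_itvoy proxy_est_gtE//.
apply: bigcupT_measurable_rat => q.
have := measurable_L_emp (clip C (ratr q)) measurableT (measurable_itv `]t, +oo[).
by rewrite setTI preimage_itvoy.
Qed.

End Measurability.

(** * Rates of convergence *)

Section Asymptotics.
Variable R : realType.

Lemma powR_ge (p K x : R) : 0 < p -> 0 < K -> K `^ p^-1 <= x -> K <= x `^ p.
Proof.
move=> p0 K0 Kx; have := ge0_ler_powR (ltW p0) _ _ Kx.
rewrite !nnegrE powR_ge0 -powRrM mulVf ?gt_eqF// powRr1 ?(ltW K0)//; apply => //.
exact: le_trans (powR_ge0 _ _) Kx.
Qed.

Lemma near_natr_ge (K : R) : \forall n \near \oo, K <= n%:R.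
Proof. exact: nbhs_infty_ger. Qed.

Lemma near_ln_ge (K : R) : \forall n \near \oo, K <= ln (n%:R : R).
Proof.
apply: filterS (near_natr_ge (expR K)) => n Kn.
by rewrite -ler_expR lnK// posrE (lt_le_trans (expR_gt0 K)).
Qed.

Lemma near_powR_ge (p K : R) : 0 < p -> 0 < K ->
  \forall n \near \oo, K <= n%:R `^ p.
Proof. by move=> p0 K0; apply: filterS (near_natr_ge _) => n; exact: powR_ge. Qed.

Lemma near_ln_powR_ge (p K : R) : 0 < p -> 0 < K ->
  \forall n \near \oo, K <= ln (n%:R : R) `^ p.
Proof. by move=> p0 K0; apply: filterS (near_ln_ge _) => n; exact: powR_ge. Qed.

(** The factor depending on C in the smallness condition of [L_dist]. It dominates C times
    [scale_sum], the factor in the conclusion of that lemma, so one quantity serves for both. *)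
Definition rate_weight (P : probability (measurableTypeR R) R) (C : R) : R :=
  C * (1 + C) * scale_sum P C.

Lemma near_rate_weight_le (P : probability (measurableTypeR R) R) (alpha eps : R) :
  0 < alpha -> alpha < 1 / 2 -> 0 < eps ->
  \forall n \near \oo, rate_weight P (ln (n%:R : R) `^ alpha) <= n%:R `^ eps.
Proof.
(* 4 [moment_rate] is the exponent of [scale_sum]; the additional 5 = 4 + 1 absorbs 2 C (1 + C) <= 4
   C^2 <= exp(4 C^2) exp(C^2). *)
move=> a0 a2 e0; pose c := 4 * moment_rate P + 5.
have c0 : 0 < c by rewrite addr_gt0// mulr_gt0// moment_rate_gt0.
have p0 : 0 < 1 - 2 * alpha by lra.
have := near_ln_powR_ge p0 (divr_gt0 c0 e0).
apply: filter_app; have := near_ln_powR_ge a0 ltr01.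
apply: filter_app; have := near_ln_ge 1.
apply: filterS => n L1 C1 LK; set L := ln (n%:R : R) in L1 C1 LK *.
set C := L `^ alpha in C1 *.
have L0 : 0 < L by lra.
have n0 : 0 < n%:R :> R.
  by rewrite ltNge; apply/negP => /ln0; rewrite -/L; lra.
have CE : C ^+ 2 = L `^ (2 * alpha).
  by rewrite -powR_mulrn ?powR_ge0// -powRrM mulrC.
have Lsplit : L = L `^ (2 * alpha) * L `^ (1 - 2 * alpha).
  have h : 2 * alpha + (1 - 2 * alpha) = 1 by ring.
  by rewrite -powRD h ?powRr1 ?(ltW L0)// oner_eq0.
have C2 : 1 <= C ^+ 2 by rewrite exprn_ege1.
(* This is where alpha < 1/2 enters: C^2 = L^(2 alpha), so the claim amounts to c / eps <= L^(1 - 2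
   alpha), with a positive exponent. *)
have cC : c * C ^+ 2 <= eps * L.
  rewrite [leRHS]mulrC -ler_pdivrMr// mulrAC Lsplit CE [leRHS]mulrC.
  by rewrite ler_wpM2r// powR_ge0.
have nE : n%:R `^ eps = expR (eps * L) by rewrite /powR gt_eqF.
rewrite nE; apply: (@le_trans _ _ (expR (c * C ^+ 2))); last by rewrite ler_expR.
have -> : c * C ^+ 2 = 4 * C ^+ 2 + C ^+ 2 + 4 * moment_rate P * C ^+ 2.
  by rewrite /c; ring.
rewrite 2!expRD.
have e1 := expR_ge1Dx (4 * C ^+ 2); have e2 := expR_ge1Dx (C ^+ 2).
have e4 : 4 <= expR (4 * C ^+ 2) by lra.
have eC : C ^+ 2 <= expR (C ^+ 2) by lra.
rewrite /rate_weight /scale_sum mulrA ler_wpM2r ?expR_ge0//.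
apply: (@le_trans _ _ (4 * C ^+ 2)); last by apply: ler_pM => //; rewrite sqr_ge0.
by rewrite expr2; nra.
Qed.

End Asymptotics.

(** * The truncation gap and the stability of the estimator *)

Section TruncationGap.
Variables (R : realType) (P : probability (measurableTypeR R) R).
Hypothesis subG : sub_gaussian P.
Local Notation sup_le C := (sup [set L_pop P l | l in [set l : R | `|l| <= C]]).
Local Notation sup_ge C := (sup [set L_pop P l | l in [set l : R | C <= `|l|]]).

Let L_pop_bounded (D : set R) l : D l -> L_pop P l <= var_proxy P.
Proof. by move=> _; exact: L_pop_le. Qed.

Let outside_neq0 (C : R) : [set l : R | C <= `|l|] !=set0.
Proof. by exists `|C|; rewrite /= normr_id ler_norm. Qed.

Lemma trunc_gap_le (C1 C2 : R) : 0 <= C1 -> C1 <= C2 ->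
  trunc_gap P C2 <= trunc_gap P C1.
Proof.
move=> C10 C12; apply: lerB.
  apply: sup_image_le => // l /= lC.
  by apply: (le_sup_image (@L_pop_bounded _)); exact: le_trans lC.
apply: sup_image_le => [|l /= lC]; first exact: ball0_neq0.
by apply: (le_sup_image (@L_pop_bounded _)); exact: le_trans C12.
Qed.

(** L comes within [e] of its supremum at some l; once C >= |l| the inner supremum is that close to
    the variance proxy, which the outer one cannot exceed. *)
Lemma trunc_gap_small (e : R) : 0 < e ->
  exists2 C0 : R, 0 <= C0 & forall C, C0 <= C -> trunc_gap P C <= e.
Proof.
move=> e0; have [l sl] : exists l, var_proxy P - e < L_pop P l.
  apply: contrapT => h.
  have Lle l : L_pop P l <= var_proxy P - e.
    by rewrite leNgt; apply/negP => ?; apply: h; exists l.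
  have t0 := le_trans (L_pop_ge0 subG 0) (Lle 0).
  have := var_proxy_le subG t0 Lle; lra.
exists `|l| => // C lC; rewrite /trunc_gap.
have h1 : sup_ge C <= var_proxy P 
  by apply: sup_image_le; [exact: outside_neq0|exact: L_pop_bounded].
have h2 : L_pop P l <= sup_le C by exact: (le_sup_image (@L_pop_bounded _)).
lra.
Qed.

(* The negative gap keeps the frequencies beyond C1 away from the supremum. *)
Lemma proxy_est_stable (x : nat -> R) (n : nat) (C1 C : R) : (0 < n)%N ->
  0 <= C1 -> C1 <= C -> trunc_gap P C1 < 0 ->
  (forall l, `|l| <= C -> `|L_emp x n l - L_pop P l| <= - trunc_gap P C1 / 4) ->
  proxy_est x n C = proxy_est x n C1.
Proof.
move=> n0 C10 C1C gap0; set g := - trunc_gap P C1 => hg.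
have [K LK] := L_emp_bounded x n0 C.
have gE : g = sup_le C1 - sup_ge C1 by rewrite /g /trunc_gap opprB.
have g0 : 0 < g by rewrite oppr_gt0.
have hK l : `|l| <= C1 -> L_emp x n l <= K by move=> ?; apply: LK; exact: le_trans C1C.
apply/eqP; rewrite eq_le; apply/andP; split; last first.
  apply: sup_image_le => [|l lC]; first exact: ball0_neq0.
  by apply: (le_sup_image LK); exact: le_trans C1C.
have sC1 : sup_le C1 <= proxy_est x n C1 + g / 4.
  apply: sup_image_le => [|l /= lC]; first exact: ball0_neq0.
  have := hg l (le_trans lC C1C); rewrite ler_norml => /andP[h _].
  have : L_emp x n l <= proxy_est x n C1 by apply: (le_sup_image hK).
  lra.
apply: sup_image_le => [|l /= lC]; first by apply: ball0_neq0; lra.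
have [lC1|/ltW lC1] := lerP `|l| C1; first exact: (le_sup_image hK).
(* Each comparison costs g / 4, once at l and once in [sC1], while passing outside C1 loses g; a
   margin of g / 2 is left. *)
have := hg l lC; rewrite ler_norml => /andP[_ h].
have : L_pop P l <= sup_ge C1 by exact: (le_sup_image (@L_pop_bounded _)).
lra.
Qed.

End TruncationGap.

(** * From the good event to consistency and rates *)

Section Rates.
Variables (R : realType) (P : probability (measurableTypeR R) R).
Hypothesis subG : sub_gaussian P.
Variables (d : measure_display) (Omega : measurableType d).
Variable Pr : probability Omega R.
Variable X : nat -> {RV Pr >-> measurableTypeR R}.
Hypothesis iid : iid_sample P X.
Let K := 6 + var_proxy P.
Local Notation sample w := (fun i => X i w).
Local Notation root n := (n%:R `^ (- (1 / 2)) : R).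
Local Notation good n A := (good_event P X n (A * root n)).

Lemma root_gt0 n : (0 < n)%N -> 0 < root n.
Proof. by move=> n0; rewrite powR_gt0// ltr0n. Qed.

Lemma mulr_root_sqr n : (0 < n)%N -> n%:R * root n ^+ 2 = 1.
Proof.
move=> n0; rewrite -powR_mulrn ?powR_ge0// -powRrM.
have -> : - (1 / 2) * 2%:R = -1 :> R by field.
by rewrite powR_inv1// divff// pnatr_eq0 -lt0n.
Qed.

(** Turns a deterministic statement on the good event into a probability bound. With a = A n^(-1/2)
    the product n a^2 is A^2, so the bound is uniform in n. *)
Lemma prob_le_good n (A : R) (E : set Omega) :
  (0 < n)%N -> 0 < A -> measurable E ->
  (forall w, good n A w -> ~ E w) -> (Pr E <= (2 / A ^+ 2)%:E)%E.
Proof.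
move=> n0 A0 mE h; have a0 : 0 < A * root n by rewrite mulr_gt0// root_gt0.
have := good_eventC_prob subG iid n0 a0.
rewrite exprMn mulrCA mulr_root_sqr// mulr1; apply: le_trans.
apply: le_measure; rewrite ?inE//; first exact: measurable_good_eventC.
by move=> w Ew gw; exact: (h w).
Qed.

Lemma prob_level (e : R) : 0 < e -> exists2 A : R, 0 < A & 2 / A ^+ 2 <= e.
Proof.
(* As 1 <= A for this choice, e A^2 >= e A >= 2. *)
move=> e0; exists (1 + 2 / e); first by rewrite addr_gt0// divr_gt0.
have A1 : 1 <= 1 + 2 / e by rewrite lerDl divr_ge0// ltW.
have A0 : 0 < 1 + 2 / e by lra.
rewrite ler_pdivrMr ?exprn_gt0//.
apply: (@le_trans _ _ (e * (1 + 2 / e))).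
  by rewrite mulrDr mulr1 [e * (2 / e)]mulrC divfK ?gt_eqF// lerDr ltW.
by rewrite ler_pM2l// expr2 ler_peMl// ltW.
Qed.

Lemma good_L_dist n (A C : R) w : (0 < n)%N -> 0 < A -> 1 <= C ->
  A * root n * rate_weight P C <= 1 / 2 -> good n A w ->
  forall l, `|l| <= C ->
    `|L_emp (sample w) n l - L_pop P l| <= K * (A * root n * rate_weight P C).
Proof.
move=> n0 A0 C1 small gw l lC; have r0 := root_gt0 n0.
have a0 : 0 <= A * root n by rewrite mulr_ge0 ?ltW.
have K0 : 0 <= K by rewrite /K addr_ge0// var_proxy_ge0.
apply: le_trans (@L_dist _ _ subG (sample w) n (A * root n) n0 a0 gw C C1 _ l lC) _.
  apply: le_trans small; rewrite /rate_weight le_eqVlt; apply/orP; left.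
  by apply/eqP; ring.
rewrite -/K ler_wpM2l// /rate_weight.
have -> : C * (A * root n * scale_sum P C) = A * root n * (C * scale_sum P C) by ring.
rewrite ler_wpM2l// -mulrA ler_wpM2l//; first exact: le_trans C1.
rewrite -[leLHS]mul1r; apply: ler_wpM2r; first exact/ltW/scale_sum_gt0.
by rewrite lerDl (le_trans ler01).
Qed.

Lemma near_rate_small (A alpha e : R) :
  0 < A -> 0 < alpha -> alpha < 1 / 2 -> 0 < e ->
  \forall n \near \oo, A * root n * rate_weight P (ln (n%:R : R) `^ alpha) <= e.
Proof.
move=> A0 a0 a2 e0.
(* Granting the weight a growth of n^(1/4) still leaves n^(-1/2) n^(1/4) = n^(-1/4), which tends to
   0. *)
have q0 : 0 < 1 / 4 :> R by lra.
have := near_powR_ge q0 (divr_gt0 A0 e0).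
apply: filter_app; have := near_rate_weight_le P a0 a2 q0.
apply: filter_app; have := near_natr_ge (1 : R).
apply: filterS => n n1 Wn Kn.
have n0 : (0 < n)%N by rewrite -(ltr0n R) (lt_le_trans ltr01).
have nq : 0 < n%:R `^ (1 / 4) :> R by rewrite powR_gt0 ?ltr0n.
apply: (@le_trans _ _ (A * root n * n%:R `^ (1 / 4))).
  by rewrite ler_wpM2l// mulr_ge0 ?ltW ?root_gt0.
rewrite -mulrA -powRD; last by rewrite pnatr_eq0 -lt0n n0 implybT.
have -> : - (1 / 2) + 1 / 4 = - (1 / 4) :> R by field.
by rewrite powRN ler_pdivrMr// mulrC -ler_pdivrMr.
Qed.

Variable alpha : R.
Hypotheses (alpha0 : 0 < alpha) (alpha2 : alpha < 1 / 2).
Let C n : R := ln (n%:R : R) `^ alpha.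
Let est n w := proxy_est (sample w) n (C n).
Let err n w := est n w - var_proxy P.

Let C_ge0 n : 0 <= C n. Proof. exact: powR_ge0. Qed.

Let near_C_ge V : 0 < V -> \forall n \near \oo, V <= C n.
Proof. exact: near_ln_powR_ge. Qed.

Lemma measurable_err n (c : R) : (0 < n)%N ->
  measurable [set w | c < `|err n w|] /\ measurable [set w | c <= `|err n w|].
Proof.
move=> n0; have m1 : measurable_fun setT (fun w => `|err n w|).
  apply: measurableT_comp => //; apply: measurable_funB => //.
  exact: measurable_proxy_est.
split.
  have := m1 measurableT `]c, +oo[%classic (measurable_itv _).
  by rewrite setTI set_itvE.
have := m1 measurableT `[c, +oo[%classic (measurable_itv _).
by rewrite setTI set_itvE.
Qed.

Lemma near_good_dist (A : R) (e : R) : 0 < A -> 0 < e ->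
  \forall n \near \oo, [/\ (0 < n)%N, 1 <= C n,
    K * (A * root n * rate_weight P (C n)) <= e &
    forall w, good n A w -> forall l, `|l| <= C n ->
      `|L_emp (sample w) n l - L_pop P l|
        <= K * (A * root n * rate_weight P (C n))].
Proof.
move=> A0 e0; have K0 : 0 < K.
  by rewrite /K ltr_wpDr// var_proxy_ge0.
have h0 : 0 < 1 / 2 :> R by lra.
have := near_rate_small A0 alpha0 alpha2 h0; apply: filter_app.
have := near_rate_small A0 alpha0 alpha2 (divr_gt0 e0 K0); apply: filter_app.
have := near_C_ge ltr01; apply: filter_app.
have := near_natr_ge (1 : R); apply: filterS => n n1 C1 small1 small2.
have n0 : (0 < n)%N by rewrite -(ltr0n R) (lt_le_trans ltr01).
split => //; first by rewrite mulrC -ler_pdivlMr.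
by move=> w gw; exact: good_L_dist.
Qed.

Lemma est_cvg_in_probability : cvg_in_probability Pr est (var_proxy P).
Proof.
(* The sampling error and the gap take e / 4 each; their sum stays strictly below e, as the event
   with a non-strict inequality requires. *)
move=> e e0; have e4 : 0 < e / 4 by lra.
have [C0 C00 gapC0] := trunc_gap_small subG e4.
(* [C0] may be 0, whereas [near_C_ge] takes a positive threshold. *)
have C01 : 0 < C0 + 1 by lra.
suff H (del : R) : 0 < del -> \forall n \near \oo,
    (Pr [set w | (e <= `|est n w - var_proxy P|)%R] <= del%:E)%E.
  have fin : \forall n \near \oo,
      Pr [set w | (e <= `|est n w - var_proxy P|)%R] \is a fin_num.
    apply: filterS (near_natr_ge (1 : R)) => n n1; apply: fin_num_measure.
    have n0 : (0 < n)%N by rewrite -(ltr0n R) (lt_le_trans ltr01).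
    exact: (measurable_err e n0).2.
  apply/fine_cvgP; split => //; apply/cvgrPdist_le => del del0.
  have := H del del0; apply: filter_app; apply: filterS fin => n finn.
  rewrite -(fineK finn) lee_fin => hdel.
  by rewrite sub0r normrN ger0_norm// fine_ge0.
move=> del0; have [A A0 Adel] := prob_level del0.
have := near_good_dist A0 e4; apply: filter_app.
have := near_C_ge C01; apply: filterS => n Cn [n0 C1 small hgood].
have := (measurable_err e n0).2.
move=> /(prob_le_good n0 A0) h; apply: (le_trans (h _)); last by rewrite lee_fin.
move=> w gw /=; apply/negP; rewrite -ltNge.
have := proxy_est_dist subG n0 (C_ge0 n) (hgood w gw).
have : Num.max (trunc_gap P (C n)) 0 <= e / 4.
  by rewrite ge_max (ltW e4) andbT gapC0// (le_trans _ Cn)// lerDl.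
rewrite /err /est; lra.
Qed.

Lemma err_bigO_eps : (exists2 C0 : R, 0 < C0 & trunc_gap P C0 <= 0) ->
  forall eps : R, 0 < eps ->
    bigO_in_probability Pr err (fun n => n%:R `^ (- (1 / 2) + eps)).
Proof.
move=> [C0 C00 gap0] eps eps0 e e0; have [A A0 Ae] := prob_level e0.
have K0 : 0 < K by rewrite /K ltr_wpDr// var_proxy_ge0.
exists (K * A); first by rewrite mulr_gt0.
have := near_good_dist A0 ltr01; apply: filter_app.
have := near_rate_weight_le P alpha0 alpha2 eps0; apply: filter_app.
have := near_C_ge C00; apply: filterS => n Cn Wn [n0 C1 small hgood].
have := (measurable_err (K * A * n%:R `^ (- (1 / 2) + eps)) n0).1.
move=> /(prob_le_good n0 A0) h; apply: (le_trans (h _)); last by rewrite lee_fin.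
move=> w gw /=; apply/negP; rewrite -leNgt.
apply: le_trans (proxy_est_dist subG n0 (C_ge0 n) (hgood w gw)) _.
rewrite (max_idPr _) ?addr0; last first.
  by apply: le_trans gap0; apply: trunc_gap_le => //; exact: ltW.
rewrite powRD; last by rewrite pnatr_eq0 -lt0n n0 implybT.
by rewrite -!mulrA !ler_pM2l// root_gt0.
Qed.

Lemma err_bigO_root : (exists2 C0 : R, 0 < C0 & trunc_gap P C0 < 0) ->
  bigO_in_probability Pr err (fun n => n%:R `^ (- (1 / 2))).
Proof.
move=> [C0 C00 gap0] e e0; have [A A0 Ae] := prob_level e0.
have K0 : 0 < K by rewrite /K ltr_wpDr// var_proxy_ge0.
(* The bounds on the good event require 1 <= C; enlarging C0 keeps the gap negative by
   monotonicity. *)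
pose C1 := Num.max C0 1.
have C11 : 1 <= C1 by rewrite le_max lexx orbT.
have C10 : 0 < C1 by rewrite (lt_le_trans ltr01).
have gap1 : trunc_gap P C1 < 0.
  by apply: le_lt_trans gap0; apply: trunc_gap_le; rewrite ?le_max ?lexx// ltW.
have g4 : 0 < - trunc_gap P C1 / 4 by rewrite divr_gt0// oppr_gt0.
have W0 : 0 < rate_weight P C1.
  by rewrite !mulr_gt0 ?expR_gt0// addr_gt0.
exists (K * (A * rate_weight P C1)); first by rewrite mulr_gt0// mulr_gt0.
have h0 : 0 < 1 / 2 :> R by lra.
have := near_good_dist A0 g4; apply: filter_app.
have := near_powR_ge h0 (divr_gt0 (mulr_gt0 A0 W0) h0); apply: filter_app.
have := near_C_ge C10; apply: filterS => n Cn Wn [n0 _ small hgood].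
have := (measurable_err (K * (A * rate_weight P C1) * root n) n0).1.
move=> /(prob_le_good n0 A0) h; apply: (le_trans (h _)); last by rewrite lee_fin.
move=> w gw /=; apply/negP; rewrite -leNgt.
have -> : K * (A * rate_weight P C1) * root n = K * (A * root n * rate_weight P C1).
  by ring.
(* From here the cut-off is the fixed [C1], so [rate_weight] is a constant that goes into the
   constant of the O_p bound. *)
rewrite /err /est (@proxy_est_stable _ _ subG _ _ C1)//; last 2 first.
- exact: ltW.
- by move=> l lC; apply: le_trans small; exact: hgood.
have sm : A * root n * rate_weight P C1 <= 1 / 2.
  have np : 0 < n%:R `^ (1 / 2) :> R by rewrite powR_gt0 ?ltr0n.
  by rewrite powRN mulrAC ler_pdivrMr// [leRHS]mulrC -ler_pdivrMr.
have := proxy_est_dist subG n0 (ltW C10) (good_L_dist n0 A0 C11 sm gw).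
by rewrite (max_idPr _) ?addr0// ltW.
Qed.

End Rates.

Theorem theorem2 (R : realType) (P : probability (measurableTypeR R) R)
    (subG : sub_gaussian P)
    (d : measure_display) (Omega : measurableType d) (Pr : probability Omega R)
    (X : nat -> {RV Pr >-> measurableTypeR R}) (iid : iid_sample P X) :
  (forall (n : nat) (C : R) (w : Omega), (0 < n)%N -> 0 < C ->
     `|proxy_est (fun i => X i w) n C - var_proxy P|
       <= sup [set `|L_emp (fun i => X i w) n l - L_pop P l|
              | l in [set l : R | `|l| <= C]]
          + Num.max (trunc_gap P C) 0)
  /\
  (forall alpha : R, 0 < alpha -> alpha < 1 / 2 ->
     let C := fun n : nat => ln (n%:R : R) `^ alpha in
     let est := fun (n : nat) (w : Omega) =>
                  proxy_est (fun i => X i w) n (C n) in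
     let err := fun (n : nat) (w : Omega) => est n w - var_proxy P in
     [/\ cvg_in_probability Pr est (var_proxy P),
         (exists2 C0 : R, 0 < C0 & trunc_gap P C0 <= 0) ->
           forall eps : R, 0 < eps ->
             bigO_in_probability Pr err (fun n => n%:R `^ (- (1 / 2) + eps))
       & (exists2 C0 : R, 0 < C0 & trunc_gap P C0 < 0) ->
           bigO_in_probability Pr err (fun n => n%:R `^ (- (1 / 2)))]).
Proof.
split=> [n C w n0 C0|alpha a0 a2 C est err].
  by apply: proxy_est_dist_sup => //; exact: ltW.
split.
- exact: est_cvg_in_probability.
- exact: err_bigO_eps.
- exact: err_bigO_root.
Qed.
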